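(* Let $n \in \mathbb{N}$ be fixed and let $a, y_j \in \mathbb{R}^+$ $(j=1,\ldots,n)$. Let $b, c, p_j, \lambda, \mu \in \mathbb{C}$ $(j=1,\ldots,n)$, put $\mathbf{p} := \sum_{j=1}^{n} p_j$, and assume $\Re(\mu+\mathbf{p})>-n$ and $\Re(\lambda)>\Re(\mu)$. Then $$\int_{0}^{\infty} x^{\mu-1}\left(x+a+\sqrt{x^{2}+2ax}\right)^{-\lambda}\prod_{j=1}^{n}\mathcal{W}_{p_j,b,c}\left(\frac{x\,y_j}{x+a+\sqrt{x^{2}+2ax}}\right)dx = \mathcal{B}\cdot F,$$ where $$\mathcal{B} = \frac{(\lambda+\mathbf{p}+n)\,2^{1-\mu-2\mathbf{p}-2n}\,a^{\mu-\lambda}\,\Gamma(\lambda-\mu)\,\Gamma(2\mu+2\mathbf{p}+2n)\,\prod_{j=1}^{n} y_j^{p_j+1}}{\left\{\Gamma\left(\frac{3}{2}\right)\right\}^{n}\,\Gamma(1+\lambda+\mu+2\mathbf{p}+2n)\,\prod_{j=1}^{n}\Gamma\left(p_j+\frac{b+2}{2}\right)}$$ and $F$ is the generalized Lauricella function $$F = F^{2:1;\cdots;1}_{2:2;\cdots;2}\left(\begin{array}{l} [2\mu+2\mathbf{p}+2n:4,\ldots,4],\ [1+\lambda+\mathbf{p}+n:2,\ldots,2] : [1:1];\cdots;[1:1]; \\ {}[1+\lambda+\mu+2\mathbf{p}+2n:4,\ldots,4],\ [\lambda+\mathbf{p}+n:2,\ldots,2] : \left[\frac{3}{2}:1\right],\left[p_1+\frac{b+2}{2}:1\right];\cdots;\left[\frac{3}{2}:1\right],\left[p_n+\frac{b+2}{2}:1\right];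 \end{array} -\frac{c\,y_1^2}{16},\ldots,-\frac{c\,y_n^2}{16}\right),$$ in which $1;\cdots;1$ and $2;\cdots;2$ are arrays of length $n$.
   Context: $\mathbb{R}^+$ is the set of positive real numbers, $\mathbb{N}$ the set of positive integers, $\Gamma$ the gamma function. Complex powers of positive reals are $t^{s}=e^{s\log t}$ with real $\log t$. The generalized Struve function is, for $p,b,c\in\mathbb{C}$, $$\mathcal{W}_{p,b,c}(z)=\sum_{k=0}^{\infty}\frac{(-c)^{k}\left(\frac{z}{2}\right)^{2k+p+1}}{\Gamma\left(k+\frac{3}{2}\right)\Gamma\left(k+p+\frac{b+2}{2}\right)}$$ (with $1/\Gamma$ equal to $0$ at the poles of $\Gamma$). The Pochhammer symbol is $(\alpha)_\nu=\Gamma(\alpha+\nu)/\Gamma(\alpha)$; in particular $(\alpha)_0=1$ and $(\alpha)_m=\alpha(\alpha+1)\cdots(\alpha+m-1)$ for $m\in\mathbb{N}$. The generalized Lauricella function (Srivastava–Daoust) $$F_{C:D^{(1)};\cdots;D^{(n)}}^{A:B^{(1)};\cdots;B^{(n)}}\left(\begin{array}{l}[(a):\theta^{(1)},\ldots,\theta^{(n)}]:[(b)^{(1)}:\phi^{(1)}];\ldots;[(b)^{(n)}:\phi^{(n)}];\\ {}[(c):\psi^{(1)},\ldots,\psi^{(n)}]:[(d)^{(1)}:\delta^{(1)}];\ldots;[(d)^{(n)}:\delta^{(n)}];\end{array} z_1,\ldots,z_n\right)$$ is defined as $\sum_{k_1,\ldots,k_n=0}^{\infty}\Omega(k_1,\ldots,k_n)\frac{z_1^{k_1}}{k_1!}\cdots\frac{z_n^{k_n}}{k_n!}$,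 where $$\Omega(k_1,\ldots,k_n)=\frac{\prod_{j=1}^{A}(a_j)_{k_1\theta_j^{(1)}+\cdots+k_n\theta_j^{(n)}}\ \prod_{m=1}^{n}\prod_{j=1}^{B^{(m)}}(b_j^{(m)})_{k_m\phi_j^{(m)}}}{\prod_{j=1}^{C}(c_j)_{k_1\psi_j^{(1)}+\cdots+k_n\psi_j^{(n)}}\ \prod_{m=1}^{n}\prod_{j=1}^{D^{(m)}}(d_j^{(m)})_{k_m\delta_j^{(m)}}}.$$ Here $(a)$ abbreviates the array $a_1,\ldots,a_A$, $(b)^{(m)}$ the array $b_1^{(m)},\ldots,b_{B^{(m)}}^{(m)}$, and similarly for $(c)$, $(d)^{(m)}$; the coefficients $\theta,\phi,\psi,\delta$ are positive reals. As usual for hypergeometric-type series, the right-hand side is understood for parameters for which it is defined, i.e. $p_j+\frac{b+2}{2}\notin\{0,-1,-2,\ldots\}$ for all $j$. *)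

(* Defs.v *)
From mathcomp Require Import all_boot.
From Stdlib Require Import Reals.
From Coquelicot Require Import Coquelicot.

Set Implicit Arguments.
Unset Strict Implicit.
Unset Printing Implicit Defensive.

Open Scope R_scope.
Open Scope C_scope.

(* Componentwise limit and sum; meaningful when both components converge. *)
Definition Clim_seq (u : nat -> C) : C :=
  (real (Lim_seq (fun k => Re (u k))), real (Lim_seq (fun k => Im (u k)))).

Definition CSeries (u : nat -> C) : C :=
  (Series (fun k => Re (u k)), Series (fun k => Im (u k))).

Definition Cexp (z : C) : C :=
  ((exp (Re z) * cos (Im z))%R, (exp (Re z) * sin (Im z))%R).

(* [t ^ s] for a positive real base [t]. *)
Definition Rcpow (t : R) (s : C) : C := Cexp (s * RtoC (ln t)).

(* Euler-Gauss limit formula, valid for every s other than 0, -1, -2, ...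
   At these poles the sequence is eventually 0 because [/ 0 = 0] in C, so that
   [Gamma s = 0] and [/ Gamma s = 0]: thus [/ Gamma] is the entire function
   1/Gamma everywhere. *)
Definition Gamma (s : C) : C :=
  Clim_seq (fun m : nat =>
    RtoC (INR m`!) * Rcpow (INR m) s
      / \big[Cmult/RtoC 1]_(k < m.+1) (s + RtoC (INR k))).

(* Meaningful when [alpha] is not a pole of Gamma. *)
Definition pochhammer (alpha : C) (nu : R) : C :=
  Gamma (alpha + RtoC nu) / Gamma alpha.

(* Generalized Struve function at a positive real argument [z]; the series
   converges absolutely for all p, b, c. *)
Definition struveW (p b c : C) (z : R) : C :=
  CSeries (fun k : nat =>
    (- c) ^ k * Rcpow (z / 2) (RtoC (INR (2 * k)) + p + 1)
      / (Gamma (RtoC (INR k) + 3 / 2) * Gamma (RtoC (INR k) + p + (b + 2) / 2))).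

(* Unconditional sum: limit along the net of finite subsets of [T]. *)
Definition is_sum_over (T : eqType) (f : T -> C) (l : C) : Prop :=
  forall eps : posreal, exists s0 : seq T, forall s : seq T,
    uniq s -> {subset s0 <= s} ->
    (Cmod (\big[Cplus/RtoC 0]_(k <- s) f k - l) < eps)%R.

Section Lauricella.

Variable n : nat.

(* [num] lists the pairs (a_j, (theta_j^(1), ..., theta_j^(n))), and [numv m]
   the pairs (b_j^(m), phi_j^(m)); likewise [den] and [denv] for c, psi and
   d, delta.  The numbers A, B^(m), C, D^(m) are the lengths of these lists. *)
Variables (num : seq (C * ('I_n -> R))) (numv : 'I_n -> seq (C * R)).
Variables (den : seq (C * ('I_n -> R))) (denv : 'I_n -> seq (C * R)).

Definition poch_joint (q : C * ('I_n -> R)) (k : 'I_n -> nat) : C :=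
  pochhammer q.1 (\big[Rplus/0%R]_(m < n) (INR (k m) * q.2 m)%R).

Definition poch_single (q : C * R) (k : nat) : C :=
  pochhammer q.1 (INR k * q.2)%R.

Definition lauricella_coef (k : 'I_n -> nat) : C :=
  (\big[Cmult/RtoC 1]_(q <- num) poch_joint q k
     * \big[Cmult/RtoC 1]_(m < n) \big[Cmult/RtoC 1]_(q <- numv m)
         poch_single q (k m))
  / (\big[Cmult/RtoC 1]_(q <- den) poch_joint q k
     * \big[Cmult/RtoC 1]_(m < n) \big[Cmult/RtoC 1]_(q <- denv m)
         poch_single q (k m)).

(* The multiple series converges at [z], with sum [l]. *)
Definition is_lauricella (z : 'I_n -> C) (l : C) : Prop :=
  is_sum_over (fun k : {ffun 'I_n -> nat} =>
    lauricella_coef k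
      * \big[Cmult/RtoC 1]_(m < n) (z m ^ k m / RtoC (INR (k m)`!))) l.

End Lauricella.

(* Main.v *)
From HB Require Import structures.
Require Import Defs.
From mathcomp Require Import all_boot.
From Stdlib Require Import Reals Lra Lia FunctionalExtensionality.
From Coquelicot Require Import Coquelicot.

Set Implicit Arguments.
Unset Strict Implicit.
Unset Printing Implicit Defensive.

Local Open Scope C_scope.

(** The Struve functions are expanded in their power series and the product is
    integrated term by term. Write X(x) = x + a + sqrt (x^2 + 2 a x), P for the sum
    of the p_j, and deg k for the sum of the entries of a multi-index k. The term
    of index k is a constant times x^(q-1) X(x)^(-l), where l and q are lambda and
    mu raised by P + n + 2 deg k, and for 0 < Re q < Re l

      int_0^oo x^(q-1) X^(-l) dx
        = 2 l a^(-l) (a/2)^q Gamma(2q) Gamma(l-q) / Gamma(1+l+q)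

    (kernel_integral). Inserting these values and writing the Gamma factors with
    Pochhammer symbols gives exactly the prefactor times the terms of the
    Lauricella series (jterm_eq).

    The integral itself comes from the substitution t = a / X(x), under which
    x = a (1-t)^2 / (2t): it becomes a^(-l) (a/2)^q times the sum of the beta
    integrals B(l-q, 2q) + B(l-q+1, 2q). With Gamma defined by the Euler-Gauss
    limit, the formula B(s,w) = Gamma(s) Gamma(w) / Gamma(s+w) (beta_Gamma) follows
    from the recurrence of B in its second argument and from
    m^s B(s, w+m+1) -> Gamma(s) as the integer m grows; the latter compares
    B(s, w+m+1) with the elementary value B(s, m+1) = m! / (s (s+1) ... (s+m)).
    Convergence of the limit and Gamma(s) <> 0 away from the poles (Gamma_lim) hold
    because consecutive terms have ratio 1 + O(1/m^2).

    The exchange of sum and integral is a domination argument. As x / X(x) < 1, the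
    term of index k is bounded by a product of d_j (k_j) times the single
    integrable function |x^(mu+P+n-1) X^(-lambda-P-n)| (fterm_bound), and each d_j
    is summable by the ratio test. Sums over cubes of multi-indices are products of
    ordinary partial sums, hence converge to the integrand, with an error that is a
    null sequence times that function (exchange_integral). The same domination,
    divided by the nonzero prefactor, makes the Lauricella series unconditionally
    summable (dominated_summable). *)

(** * Complex sequences *)

Lemma C_eq (z w : C) : Re z = Re w -> Im z = Im w -> z = w.
Proof. by case: z w => [a b] [c d] /= -> ->. Qed.

Lemma Re_plus (z w : C) : Re (z + w) = (Re z + Re w)%R. Proof. by []. Qed.
Lemma Im_plus (z w : C) : Im (z + w) = (Im z + Im w)%R. Proof. by []. Qed.
Lemma Re_opp (z : C) : Re (- z) = (- Re z)%R. Proof. by []. Qed.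
Lemma Im_opp (z : C) : Im (- z) = (- Im z)%R. Proof. by []. Qed.
Lemma Re_minus (z w : C) : Re (z - w) = (Re z - Re w)%R. Proof. by []. Qed.
Lemma Im_minus (z w : C) : Im (z - w) = (Im z - Im w)%R. Proof. by []. Qed.
Lemma Re_mult (z w : C) : Re (z * w) = (Re z * Re w - Im z * Im w)%R.
Proof. by []. Qed.
Lemma Im_mult (z w : C) : Im (z * w) = (Re z * Im w + Im z * Re w)%R.
Proof. by []. Qed.

Lemma Cplus_eq_reg_r (r z w : C) : z + r = w + r -> z = w.
Proof.
by move=> h; rewrite (_ : z = z + r - r); [rewrite h; ring | ring].
Qed.

Lemma Cinv_neq0 (z : C) : z <> 0 -> / z <> 0.
Proof.
by move=> h e; apply: C1_nz; rewrite -(Cinv_r z) // e Cmult_0_r.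
Qed.

Lemma Im_le_Cmod (z : C) : (Rabs (Im z) <= Cmod z)%R.
Proof. by apply: Rle_trans (Rmax_Cmod z); apply: Rmax_r. Qed.

Lemma Cmod_le_ReIm (z : C) : (Cmod z <= Rabs (Re z) + Rabs (Im z))%R.
Proof.
have {1}-> : z = (RtoC (Re z) + Ci * RtoC (Im z))%C.
  by apply: C_eq => /=; ring.
apply: Rle_trans (Cmod_triangle _ _) _.
by rewrite Cmod_mult Cmod_Ci !Cmod_R Rmult_1_l; apply: Rle_refl.
Qed.

Lemma Cmod_triangle_rev (z w : C) : (Cmod z - Cmod w <= Cmod (z - w))%R.
Proof.
have := Cmod_triangle (z - w) w.
by rewrite (_ : (z - w + w = z)%C); [lra | ring].
Qed.

Lemma Cmod_minusC (z w : C) : Cmod (z - w) = Cmod (w - z).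
Proof. by rewrite -Cmod_opp; congr Cmod; ring. Qed.

Lemma Cneq0_Re (z : C) : (0 < Re z)%R -> z <> 0.
Proof. by move=> h e; move: h; rewrite e /=; lra. Qed.

Lemma exp_monotone (x y : R) : (x <= y)%R -> (exp x <= exp y)%R.
Proof.
by case=> [h|->]; [apply/Rlt_le/exp_increasing | apply: Rle_refl].
Qed.

Definition clim (u : nat -> C) (l : C) : Prop :=
  is_lim_seq (fun n => Cmod (u n - l)) 0.

Lemma squeeze0 (u e : nat -> R) (M : nat) :
  (forall n, (M <= n)%coq_nat -> 0 <= u n <= e n)%R ->
  is_lim_seq e 0 -> is_lim_seq u 0.
Proof.
move=> h he; apply: (is_lim_seq_le_le_loc (fun=> 0%R) u e) => //.
  by exists M => n hn; apply: h.
exact: is_lim_seq_const.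
Qed.

Lemma clim_squeeze (u : nat -> C) (l : C) (e : nat -> R) (M : nat) :
  (forall n, (M <= n)%coq_nat -> Cmod (u n - l) <= e n)%R ->
  is_lim_seq e 0 -> clim u l.
Proof.
move=> h; apply: (@squeeze0 _ _ M) => n hn; split; first exact: Cmod_ge_0.
exact: h.
Qed.

Lemma clim_ReIm u l : clim u l ->
  is_lim_seq (fun n => Re (u n)) (Re l) /\ is_lim_seq (fun n => Im (u n)) (Im l).
Proof.
move=> h; split.
- apply: (is_lim_seq_ext (fun n => Re (u n - l)%C + Re l)%R).
    by move=> n; rewrite Re_plus Re_opp; ring.
  rewrite -[X in is_lim_seq _ (Finite X)]Rplus_0_l.
  apply: is_lim_seq_plus'; last exact: is_lim_seq_const.
  apply/is_lim_seq_abs_0; apply: (@squeeze0 _ _ 0 _ h) => n _.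
  by split; [apply: Rabs_pos | apply: re_le_Cmod].
- apply: (is_lim_seq_ext (fun n => Im (u n - l)%C + Im l)%R).
    by move=> n; rewrite Im_plus Im_opp; ring.
  rewrite -[X in is_lim_seq _ (Finite X)]Rplus_0_l.
  apply: is_lim_seq_plus'; last exact: is_lim_seq_const.
  apply/is_lim_seq_abs_0; apply: (@squeeze0 _ _ 0 _ h) => n _.
  by split; [apply: Rabs_pos | apply: Im_le_Cmod].
Qed.

Lemma clim_of_ReIm u (l : C) :
  is_lim_seq (fun n => Re (u n)) (Re l) -> is_lim_seq (fun n => Im (u n)) (Im l) ->
  clim u l.
Proof.
move=> h1 h2.
have k (v : nat -> R) (m : R) : is_lim_seq v m ->
    is_lim_seq (fun n => Rabs (v n - m)) 0.
  move=> h; apply/(is_lim_seq_abs_0 (fun n => v n - m)%R).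
  rewrite -(Rminus_diag_eq m m erefl).
  by apply: is_lim_seq_minus' => //; apply: is_lim_seq_const.
apply: (@clim_squeeze _ _
  (fun n => Rabs (Re (u n) - Re l) + Rabs (Im (u n) - Im l))%R 0).
  by move=> n _; apply: Cmod_le_ReIm.
rewrite -[0%R]Rplus_0_l; apply: is_lim_seq_plus'; exact: k.
Qed.

Lemma clim_unique u l l' : clim u l -> clim u l' -> l = l'.
Proof.
move=> /clim_ReIm [h1 h2] /clim_ReIm [h3 h4]; apply: C_eq.
- by have := is_lim_seq_unique _ _ h1; rewrite (is_lim_seq_unique _ _ h3); case.
- by have := is_lim_seq_unique _ _ h2; rewrite (is_lim_seq_unique _ _ h4); case.
Qed.

Lemma Clim_seq_eq u l : clim u l -> Clim_seq u = l.
Proof.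
move=> /clim_ReIm [h1 h2]; apply: C_eq => /=.
- by rewrite (is_lim_seq_unique _ _ h1).
- by rewrite (is_lim_seq_unique _ _ h2).
Qed.

Lemma clim_ext_loc u v l (M : nat) :
  (forall n, (M <= n)%coq_nat -> u n = v n) -> clim u l -> clim v l.
Proof.
move=> h; apply: is_lim_seq_ext_loc; exists M => n hn; by rewrite (h n hn).
Qed.

Lemma clim_const l : clim (fun=> l) l.
Proof.
apply: (@clim_squeeze _ _ (fun=> 0%R) 0); last exact: is_lim_seq_const.
move=> n _; rewrite (_ : (l - l = 0)%C); last by ring.
by rewrite Cmod_0; apply: Rle_refl.
Qed.

Lemma clim_mod u l : clim u l -> is_lim_seq (fun n => Cmod (u n)) (Cmod l).
Proof.
move=> h.
apply: (is_lim_seq_ext (fun n => (Cmod (u n) - Cmod l) + Cmod l)%R).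
  by move=> n; ring.
rewrite -[X in is_lim_seq _ (Finite X)]Rplus_0_l.
apply: is_lim_seq_plus'; last exact: is_lim_seq_const.
apply/is_lim_seq_abs_0; apply: (@squeeze0 _ _ 0 _ h) => n _.
split; first exact: Rabs_pos.
apply: Rabs_le; split; last exact: Cmod_triangle_rev.
by have := Cmod_triangle_rev l (u n); rewrite (Cmod_minusC l); lra.
Qed.

Lemma clim_plus u v l m : clim u l -> clim v m -> clim (fun n => u n + v n) (l + m).
Proof.
move=> h1 h2.
apply: (@clim_squeeze _ _ (fun n => Cmod (u n - l) + Cmod (v n - m))%R 0).
  move=> n _; rewrite (_ : (u n + v n - (l + m) = (u n - l) + (v n - m))%C);
    last by ring.
  exact: Cmod_triangle.
by rewrite -[0%R]Rplus_0_l; apply: is_lim_seq_plus'.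
Qed.

Lemma clim_mult u v l m : clim u l -> clim v m -> clim (fun n => u n * v n) (l * m).
Proof.
move=> h1 h2.
apply: (@clim_squeeze _ _
  (fun n => Cmod (u n) * Cmod (v n - m) + Cmod (u n - l) * Cmod m)%R 0).
  move=> n _.
  rewrite (_ : (u n * v n - l * m = u n * (v n - m) + (u n - l) * m)%C);
    last by ring.
  by apply: Rle_trans (Cmod_triangle _ _) _; rewrite !Cmod_mult; apply: Rle_refl.
rewrite (_ : 0%R = (Cmod l * 0 + 0 * Cmod m)%R); last by ring.
apply: is_lim_seq_plus'; apply: is_lim_seq_mult' => //.
- exact: clim_mod.
- exact: is_lim_seq_const.
Qed.

Lemma clim_opp u l : clim u l -> clim (fun n => - u n) (- l).
Proof.
move=> h; apply: (@clim_squeeze _ _ _ 0 _ h) => n _.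
rewrite (_ : (- u n - - l = - (u n - l))%C); last by ring.
by rewrite Cmod_opp; apply: Rle_refl.
Qed.

Lemma clim_inv (u : nat -> C) (l : C) : l <> 0 -> (forall n, u n <> 0) ->
  clim u l -> clim (fun n => / u n) (/ l).
Proof.
move=> hl hu h.
have hl0 : (0 < Cmod l)%R by apply/Cmod_gt_0.
have hu0 n : (0 < Cmod (u n))%R by apply/Cmod_gt_0.
apply: (@clim_squeeze _ _
  (fun n => Cmod (u n - l) * (/ Cmod (u n) * / Cmod l))%R 0).
  move=> n _; rewrite (_ : (/ u n - / l = - (u n - l) * (/ u n * / l))%C);
    last by field.
  by rewrite !Cmod_mult Cmod_opp !Cmod_inv //; apply: Rle_refl.
rewrite (_ : 0%R = (0 * (/ Cmod l * / Cmod l))%R); last by ring.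
apply: is_lim_seq_mult' => //.
apply: is_lim_seq_mult'; last exact: is_lim_seq_const.
apply: (is_lim_seq_inv _ (Cmod l)); first exact: clim_mod.
by move=> [e]; lra.
Qed.

Lemma clim_cauchy u (e : nat -> R) (M : nat) :
  (forall m n, (M <= m)%coq_nat -> (m <= n)%coq_nat -> Cmod (u n - u m) <= e m)%R ->
  is_lim_seq e 0 -> exists l, clim u l.
Proof.
move=> h he.
have key (f : C -> R) : (forall z : C, Rabs (f z) <= Cmod z)%R ->
    (forall z w : C, f (z - w)%C = f z - f w)%R ->
    exists l : R, is_lim_seq (fun n => f (u n)) l.
  move=> hf hf'; apply/ex_lim_seq_cauchy_corr => eps.
  have /is_lim_seq_spec /(_ eps) [N hN] := he.
  have aux m n : (maxn M N <= m)%coq_nat -> (m <= n)%coq_nat ->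
      (Rabs (f (u n) - f (u m)) < eps)%R.
    move=> hm hmn; rewrite -hf'; apply: Rle_lt_trans (hf _) _.
    have hM : (M <= m)%coq_nat by apply: Nat.le_trans hm; apply/leP/leq_maxl.
    have hN' : (N <= m)%coq_nat by apply: Nat.le_trans hm; apply/leP/leq_maxr.
    apply: Rle_lt_trans (h _ _ hM hmn) _.
    by have := hN m hN'; rewrite Rminus_0_r => /Rabs_def2 [].
  exists (maxn M N) => m n hm hn; case: (Nat.le_ge_cases m n) => hmn.
    by rewrite Rabs_minus_sym; apply: aux.
  exact: aux.
have [l1 h1] := key Re (fun z => re_le_Cmod z) (fun _ _ => erefl).
have [l2 h2] := key Im Im_le_Cmod (fun _ _ => erefl).
by exists (l1, l2); apply: clim_of_ReIm.
Qed.

(** Convergence of an infinite product to a nonzero limit. The relative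
    increments are bounded by the steps of a sequence e tending to 0, so from the
    index M on the modulus lies between 1/2 and exp (1/2) times its value at M:
    the upper bound makes the sequence Cauchy, the lower one keeps the limit away
    from 0. *)
Lemma clim_ratio (u : nat -> C) (e : nat -> R) (M : nat) :
  u M <> 0 -> (e M <= / 2)%R -> (forall m, 0 <= e m)%R -> is_lim_seq e 0 ->
  (forall m, (M <= m)%coq_nat ->
     Cmod (u m.+1 - u m) <= Cmod (u m) * (e m - e m.+1))%R ->
  exists l, clim u l /\ l <> 0.
Proof.
move=> hM heM he0 he h.
have hM0 : (0 < Cmod (u M))%R by apply/Cmod_gt_0.
have hlow m : (M <= m)%coq_nat ->
    (0 < Cmod (u m) /\ e m <= e M /\ Cmod (u M) * (1 - (e M - e m)) <= Cmod (u m)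
     /\ Cmod (u m) <= Cmod (u M) * exp (e M - e m))%R.
  elim=> [|{}m hm [IH0 [IH1 [IH2 IH3]]]].
    by rewrite Rminus_diag exp_0; repeat split; lra.
  have hs := h m hm.
  have hd : (0 <= e m - e m.+1)%R.
    apply: (Rmult_le_reg_l (Cmod (u m))) => //; rewrite Rmult_0_r.
    by apply: Rle_trans hs; apply: Cmod_ge_0.
  have h1 := Cmod_triangle_rev (u m) (u m.+1).
  have h2 := Cmod_triangle_rev (u m.+1) (u m).
  rewrite (Cmod_minusC (u m)) in h1.
  have h3 : (Cmod (u M) * (1 - (e M - e m.+1)) <= Cmod (u m.+1))%R.
    apply: Rle_trans (_ : Cmod (u m) * (1 - (e m - e m.+1)) <= _)%R; last lra.
    have q : (0 <= 1 - (e m - e m.+1))%R by have := he0 m.+1; lra.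
    apply: Rle_trans (Rmult_le_compat_r _ _ _ q IH2).
    have : (0 <= Cmod (u M) * ((e M - e m) * (e m - e m.+1)))%R.
      by apply: Rmult_le_pos; [lra | apply: Rmult_le_pos; lra].
    by nra.
  repeat split => //; [|lra|].
    apply: Rlt_le_trans h3; apply: Rmult_lt_0_compat => //.
    by have := he0 m.+1; lra.
  rewrite (_ : (e M - e m.+1 = (e M - e m) + (e m - e m.+1))%R); last by ring.
  rewrite exp_plus -Rmult_assoc.
  apply: Rle_trans (_ : Cmod (u m) * (1 + (e m - e m.+1)) <= _)%R; first lra.
  apply: Rmult_le_compat; [lra | lra | exact: IH3 | ].
  by case: (Req_dec (e m - e m.+1) 0) => [->|hne];
    [rewrite exp_0; lra | apply/Rlt_le/exp_ineq1].
have hup m : (M <= m)%coq_nat -> (Cmod (u m) <= Cmod (u M) * exp (e M))%R.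
  move=> hm; have [_ [h1 [_ h3]]] := hlow m hm.
  apply: Rle_trans h3 _; apply: Rmult_le_compat_l; first lra.
  by apply: exp_monotone; have := he0 m; lra.
have [||l hl] := @clim_cauchy u (fun m => Cmod (u M) * exp (e M) * e m)%R M.
- move=> m n hm hmn.
  have hK : (0 < Cmod (u M) * exp (e M))%R.
    by apply: Rmult_lt_0_compat => //; apply: exp_pos.
  apply: Rle_trans (_ : Cmod (u M) * exp (e M) * (e m - e n) <= _)%R; last first.
    by apply: Rmult_le_compat_l; [lra | have := he0 n; lra].
  elim: hmn => [|{}n hmn IH].
    rewrite (_ : (u m - u m = 0)%C); last by ring.
    by rewrite Cmod_0 Rminus_diag; lra.
  rewrite (_ : (u n.+1 - u m = (u n.+1 - u n) + (u n - u m))%C); last by ring.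
  apply: Rle_trans (Cmod_triangle _ _) _.
  have hn : (M <= n)%coq_nat by lia.
  have := h n hn.
  have hd : (0 <= e n - e n.+1)%R.
    have [h0 _] := hlow n hn.
    apply: (Rmult_le_reg_l (Cmod (u n))) => //; rewrite Rmult_0_r.
    by apply: Rle_trans (h n hn); apply: Cmod_ge_0.
  have := Rmult_le_compat_r _ _ _ hd (hup n hn).
  by lra.
- rewrite -(Rmult_0_r (Cmod (u M) * exp (e M))).
  by apply: is_lim_seq_mult' => //; apply: is_lim_seq_const.
exists l; split => // hl0.
have : Rbar_le (Finite (Cmod (u M) * / 2)) (Finite (Cmod l)).
  apply: (is_lim_seq_le_loc (fun=> Cmod (u M) * / 2)%R (fun n => Cmod (u n))).
  - exists M => n hn; have [_ [h1 [h2 _]]] := hlow n hn.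
    apply: Rle_trans h2; apply: Rmult_le_compat_l; first lra.
    by have := he0 n; lra.
  - exact: is_lim_seq_const.
  - exact: clim_mod.
by rewrite hl0 Cmod_0 /=; lra.
Qed.

(** * The complex exponential and powers of positive reals *)

Lemma Cexp_plus (z w : C) : Cexp (z + w) = Cexp z * Cexp w.
Proof.
by apply: C_eq; rewrite /= /Re /Im exp_plus ?cos_plus ?sin_plus; ring.
Qed.

Lemma Cexp_0 : Cexp 0 = 1.
Proof. by apply: C_eq => /=; rewrite exp_0 ?cos_0 ?sin_0; ring. Qed.

Lemma Cexp_RtoC (x : R) : Cexp (RtoC x) = RtoC (exp x).
Proof. by apply: C_eq; rewrite /Cexp /= ?cos_0 ?sin_0; ring. Qed.

Lemma Cmod_Cexp (z : C) : Cmod (Cexp z) = exp (Re z).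
Proof.
rewrite /Cmod /= !Rmult_1_r.
rewrite (_ : (_ + _)%R = (exp (Re z) * exp (Re z)
   * (Rsqr (sin (Im z)) + Rsqr (cos (Im z))))%R); last by rewrite /Rsqr; ring.
by rewrite sin2_cos2 Rmult_1_r sqrt_square //; apply/Rlt_le/exp_pos.
Qed.

Lemma Cexp_neq0 (z : C) : Cexp z <> 0.
Proof. by apply/Cmod_gt_0; rewrite Cmod_Cexp; apply: exp_pos. Qed.

Lemma Cexp_opp (z : C) : Cexp (- z) = / Cexp z.
Proof.
have h : Cexp (- z) * Cexp z = 1.
  by rewrite -Cexp_plus (_ : (- z + z = 0)%C) ?Cexp_0 //; ring.
have h0 := @Cexp_neq0 z.
by rewrite -[LHS]Cmult_1_r -(Cinv_r (Cexp z)) // Cmult_assoc h Cmult_1_l.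
Qed.

(** Derivatives and continuity are taken on real and imaginary parts, so that
    the real fundamental theorem of calculus and mean value theorem apply to each
    part. *)
Definition cderiv (f : R -> C) (t : R) (l : C) : Prop :=
  is_derive (fun x => Re (f x)) t (Re l) /\ is_derive (fun x => Im (f x)) t (Im l).

Definition ccont (f : R -> C) (t : R) : Prop :=
  continuous (fun x => Re (f x)) t /\ continuous (fun x => Im (f x)) t.

Lemma cderiv_ccont f t l : cderiv f t l -> ccont f t.
Proof.
by case=> h1 h2; split; apply: ex_derive_continuous; [exists (Re l) | exists (Im l)].
Qed.

Lemma ccont_const z t : ccont (fun=> z) t.
Proof. by split; apply: continuous_const. Qed.

Lemma ccont_plus f g t : ccont f t -> ccont g t -> ccont (fun x => f x + g x) t.
Proof.
move=> [h1 h2] [h3 h4]; split.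
- exact: (continuous_plus (fun x => Re (f x)) (fun x => Re (g x))).
- exact: (continuous_plus (fun x => Im (f x)) (fun x => Im (g x))).
Qed.

Lemma ccont_mult f g t : ccont f t -> ccont g t -> ccont (fun x => f x * g x) t.
Proof.
move=> [h1 h2] [h3 h4]; split.
- apply: (continuous_minus (fun x => Re (f x) * Re (g x))%R
    (fun x => Im (f x) * Im (g x))%R);
  exact: (continuous_mult (K := R_AbsRing)).
- apply: (continuous_plus (fun x => Re (f x) * Im (g x))%R
    (fun x => Im (f x) * Re (g x))%R);
  exact: (continuous_mult (K := R_AbsRing)).
Qed.

Lemma cderiv_mult f g t l m : cderiv f t l -> cderiv g t m ->
  cderiv (fun x => f x * g x) t (l * g t + f t * m).
Proof.
have hm (a b : R -> R) (x y : R) : is_derive a t x -> is_derive b t y ->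
    is_derive (fun x => a x * b x)%R t (x * b t + a t * y)%R.
  by move=> ha hb; apply: (is_derive_mult a b) => //; apply: Rmult_comm.
move=> [h1 h2] [h3 h4]; split.
- rewrite (_ : Re _ = minus (Re l * Re (g t) + Re (f t) * Re m)%R
    (Im l * Im (g t) + Im (f t) * Im m)%R); last by rewrite /minus /plus /opp /= /Re /Im; ring.
  by apply: (is_derive_minus (fun x => Re (f x) * Re (g x))%R
    (fun x => Im (f x) * Im (g x))%R); apply: hm.
- rewrite (_ : Im _ = plus (Re l * Im (g t) + Re (f t) * Im m)%R
    (Im l * Re (g t) + Im (f t) * Re m)%R); last by rewrite /plus /= /Re /Im; ring.
  by apply: (is_derive_plus (fun x => Re (f x) * Im (g x))%R
    (fun x => Im (f x) * Re (g x))%R); apply: hm.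
Qed.

Lemma cderiv_exp_comp (s : C) (g : R -> R) (t d : R) : is_derive g t d ->
  cderiv (fun x => Cexp (s * RtoC (g x))) t (s * RtoC d * Cexp (s * RtoC (g t))).
Proof.
move=> hg; have hd : Derive g t = d by apply: is_derive_unique.
have he : ex_derive (fun x => g x) t by exists d.
split => /=; auto_derive => //; rewrite hd /Re /Im /=;
  rewrite !(Rmult_0_r, Ropp_0, Rplus_0_r, Rplus_0_l, Rminus_0_r); ring.
Qed.

(** There is no complex mean value equality, but the real function
    t |-> Re (conj (F v - F u) * F t) obeys the real one, and its increment is the
    square of the modulus of F v - F u. *)
Lemma cderiv_bound (F f : R -> C) (u v K : R) : (u <= v)%R ->
  (forall t, u <= t <= v -> cderiv F t (f t))%R ->
  (forall t, u <= t <= v -> Cmod (f t) <= K)%R ->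
  (Cmod (F v - F u) <= K * (v - u))%R.
Proof.
move=> huv hd hb.
set w := F v - F u.
pose phi x := (Re w * Re (F x) + Im w * Im (F x))%R.
pose dphi x := (Re w * Re (f x) + Im w * Im (f x))%R.
have hphi x : (u <= x <= v)%R -> is_derive phi x (dphi x).
  move=> hx; have [h1 h2] := hd x hx.
  apply: (is_derive_plus (fun x => Re w * Re (F x))%R (fun x => Im w * Im (F x))%R);
  by apply: is_derive_scal.
have [||x [hx he]] := @MVT_gen phi u v dphi.
- by move=> x hx; apply: hphi; move: hx; rewrite Rmin_left // Rmax_right //; lra.
- move=> x; rewrite Rmin_left // Rmax_right // => hx.
  apply/continuity_pt_filterlim/(ex_derive_continuous (V := R_NormedModule)).
  by exists (dphi x); apply: hphi.
move: hx; rewrite Rmin_left // Rmax_right // => hx.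
have hw : (Cmod w * Cmod w = phi v - phi u)%R.
  rewrite (_ : (Cmod w * Cmod w = Cmod w ^ 2)%R); last by ring.
  rewrite Cmod2_alt.
  by rewrite /phi /w Re_minus Im_minus; ring.
have hdp : (dphi x <= Cmod w * Cmod (f x))%R.
  rewrite -(Cmod_conj w) -Cmod_mult.
  rewrite (_ : dphi x = Re (Cconj w * f x)); last by rewrite Re_mult /dphi /Re /Im /=; ring.
  by apply: Rle_trans (re_le_Cmod _); apply: Rle_abs.
case: (Rle_lt_or_eq_dec 0 (Cmod w) (Cmod_ge_0 w)) => [hpos|<-]; last first.
  by apply: Rmult_le_pos; [apply: Rle_trans (hb u _); [apply: Cmod_ge_0 | lra] | lra].
apply: (Rmult_le_reg_l (Cmod w)) => //; rewrite hw he.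
have hK := hb x hx; rewrite -Rmult_assoc.
apply: Rmult_le_compat_r; first lra.
apply: Rle_trans hdp _; apply: Rmult_le_compat_l; lra.
Qed.

Lemma cderiv_Cexp_line (z : C) (t : R) :
  cderiv (fun x => Cexp (z * RtoC x)) t (z * Cexp (z * RtoC t)).
Proof.
have := @cderiv_exp_comp z (fun x => x) t 1 (is_derive_id t).
by rewrite Cmult_1_r.
Qed.

Lemma Cexp_minus1 (z : C) (K : R) : (forall t, 0 <= t <= 1 -> exp (t * Re z) <= K)%R ->
  (Cmod (Cexp z - 1) <= Cmod z * K)%R.
Proof.
move=> hK.
have := @cderiv_bound (fun x => Cexp (z * RtoC x)) (fun x => z * Cexp (z * RtoC x))
  0 1 (Cmod z * K) Rle_0_1 (fun t _ => @cderiv_Cexp_line z t).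
rewrite Cmult_1_r Cmult_0_r Cexp_0 Rminus_0_r Rmult_1_r; apply => t ht.
rewrite Cmod_mult; apply: Rmult_le_compat_l; first exact: Cmod_ge_0.
by rewrite Cmod_Cexp (_ : Re _ = (t * Re z)%R); [apply: hK | rewrite /= /Re /Im; ring].
Qed.

Lemma Cexp_minus1_le (z : C) : (Re z <= 0)%R -> (Cmod (Cexp z - 1) <= Cmod z)%R.
Proof.
move=> hz; rewrite -[X in (_ <= X)%R]Rmult_1_r; apply: Cexp_minus1 => t ht.
by rewrite -exp_0; apply: exp_monotone; nra.
Qed.

Lemma Cexp_minus1_norm (z : C) : (Cmod (Cexp z - 1) <= Cmod z * exp (Cmod z))%R.
Proof.
apply: Cexp_minus1 => t ht; apply: exp_monotone.
have h := re_le_Cmod z; have h' := Rle_abs (Re z).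
have := Cmod_ge_0 z => h0.
by case: (Rle_dec 0 (Re z)) => h1; nra.
Qed.

Lemma Cexp_minus1_order2 (z : C) :
  (Cmod (Cexp z - 1 - z) <= Cmod z * (Cmod z * exp (Cmod z)))%R.
Proof.
have := @cderiv_bound (fun x => Cexp (z * RtoC x) + (- z) * RtoC x)
  (fun x => z * (Cexp (z * RtoC x) - 1)) 0 1 (Cmod z * (Cmod z * exp (Cmod z))) Rle_0_1.
rewrite !Cmult_1_r !Cmult_0_r Cexp_0 Rminus_0_r Rmult_1_r.
rewrite (_ : (Cexp z + - z - (1 + 0) = Cexp z - 1 - z)%C); last by ring.
apply => t ht.
  have [h1 h2] := @cderiv_Cexp_line z t.
  have hl (k : R) : is_derive (fun x => k * x)%R t k.
    by auto_derive => //; ring.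
  split.
  - apply: (is_derive_ext (fun x => plus (Re (Cexp (z * RtoC x))) (- Re z * x)%R)).
      by move=> x; rewrite /plus /= /Re /Im; ring.
    rewrite [X in is_derive _ _ X](_ : _ = plus (Re (z * Cexp (z * RtoC t))) (- Re z)%R);
      last by rewrite /plus /= /Re /Im; ring.
    exact: is_derive_plus.
  - apply: (is_derive_ext (fun x => plus (Im (Cexp (z * RtoC x))) (- Im z * x)%R)).
      by move=> x; rewrite /plus /= /Re /Im; ring.
    rewrite [X in is_derive _ _ X](_ : _ = plus (Im (z * Cexp (z * RtoC t))) (- Im z)%R);
      last by rewrite /plus /= /Re /Im; ring.
    exact: is_derive_plus.
rewrite Cmod_mult; apply: Rmult_le_compat_l; first exact: Cmod_ge_0.
apply: Rle_trans (Cexp_minus1_norm _) _.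
rewrite Cmod_mult Cmod_R Rabs_pos_eq; last lra.
have := Cmod_ge_0 z => h0.
apply: Rmult_le_compat; [nra | apply/Rlt_le/exp_pos | nra | ].
by apply: exp_monotone; nra.
Qed.

Lemma Rcpow_plus x s t : Rcpow x (s + t) = Rcpow x s * Rcpow x t.
Proof. by rewrite /Rcpow -Cexp_plus; congr Cexp; ring. Qed.

Lemma Rcpow_opp x s : Rcpow x (- s) = / Rcpow x s.
Proof. by rewrite /Rcpow -Cexp_opp; congr Cexp; ring. Qed.

Lemma Rcpow_0 x : Rcpow x 0 = 1.
Proof. by rewrite /Rcpow Cmult_0_l Cexp_0. Qed.

Lemma Rcpow_neq0 x s : Rcpow x s <> 0.
Proof. exact: Cexp_neq0. Qed.

Lemma Rcpow_1 x : (0 < x)%R -> Rcpow x 1 = RtoC x.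
Proof.
by move=> hx; rewrite /Rcpow Cmult_1_l Cexp_RtoC exp_ln. Qed.

Lemma Rcpow_base1 s : Rcpow 1 s = 1.
Proof. by rewrite /Rcpow ln_1 Cmult_0_r Cexp_0. Qed.

Lemma Rcpow_mult x y s : (0 < x)%R -> (0 < y)%R ->
  Rcpow (x * y) s = Rcpow x s * Rcpow y s.
Proof. by move=> hx hy; rewrite /Rcpow ln_mult // RtoC_plus Cmult_plus_distr_l Cexp_plus. Qed.

Lemma Rcpow_inv x s : (0 < x)%R -> Rcpow (/ x) s = Rcpow x (- s).
Proof. by move=> hx; rewrite /Rcpow ln_Rinv // RtoC_opp; congr Cexp; ring. Qed.

Lemma Rcpow_div x y s : (0 < x)%R -> (0 < y)%R ->
  Rcpow (x / y) s = Rcpow x s / Rcpow y s.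
Proof.
move=> hx hy; rewrite /Rdiv Rcpow_mult //; last exact: Rinv_0_lt_compat.
by rewrite Rcpow_inv // Rcpow_opp.
Qed.

Lemma Rcpow_nat x k : (0 < x)%R -> Rcpow x (RtoC (INR k)) = RtoC x ^ k.
Proof.
move=> hx; elim: k => [|k IH]; first exact: Rcpow_0.
by rewrite S_INR RtoC_plus Rcpow_plus IH Rcpow_1 // Cpow_S Cmult_comm.
Qed.

Lemma Cmod_Rcpow x s : Cmod (Rcpow x s) = exp (Re s * ln x).
Proof. by rewrite /Rcpow Cmod_Cexp Re_mult /= Rmult_0_r Rminus_0_r. Qed.

Lemma Rcpow_real x r : Rcpow x (RtoC r) = RtoC (exp (r * ln x)).
Proof.
by rewrite /Rcpow -RtoC_mult Cexp_RtoC. Qed.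

Lemma cderiv_Rcpow s (t : R) : (0 < t)%R ->
  cderiv (fun x => Rcpow x s) t (s * Rcpow t (s - 1)).
Proof.
move=> ht.
have := @cderiv_exp_comp s ln t (/ t) (is_derive_ln t ht).
rewrite (_ : s * Rcpow t (s - 1) = s * RtoC (/ t) * Cexp (s * RtoC (ln t))) //.
rewrite (_ : (s - 1 = s + - (1))%C) // Rcpow_plus Rcpow_opp Rcpow_1 // RtoC_inv;
  last lra.
by rewrite /Rcpow; ring.
Qed.

Lemma cderiv_Rcpow_1m s (t : R) : (t < 1)%R ->
  cderiv (fun x => Rcpow (1 - x) s) t (- s * Rcpow (1 - t) (s - 1)).
Proof.
move=> ht.
have hd : is_derive (fun x => ln (1 - x)) t (- / (1 - t))%R.
  by auto_derive; [lra | field; lra].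
have := @cderiv_exp_comp s _ t _ hd.
rewrite (_ : - s * Rcpow (1 - t) (s - 1) =
  s * RtoC (- / (1 - t)) * Cexp (s * RtoC (ln (1 - t)))) //.
rewrite (_ : (s - 1 = s + - (1))%C) // Rcpow_plus Rcpow_opp Rcpow_1; last lra.
rewrite RtoC_opp RtoC_inv; last lra.
by rewrite /Rcpow; ring.
Qed.

(** * The gamma function through the Euler-Gauss limit *)

HB.instance Definition _ := Monoid.isComLaw.Build C (RtoC 0) Cplus
  Cplus_assoc Cplus_comm Cplus_0_l.
HB.instance Definition _ := Monoid.isComLaw.Build C (RtoC 1) Cmult
  Cmult_assoc Cmult_comm Cmult_1_l.
HB.instance Definition _ := Monoid.isMulLaw.Build C (RtoC 0) Cmult
  Cmult_0_l Cmult_0_r.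
HB.instance Definition _ := Monoid.isAddLaw.Build C Cmult Cplus
  (fun x y z => Cmult_plus_distr_r x y z) (fun x y z => Cmult_plus_distr_l x y z).

Lemma Cprod_neq0 (I : Type) (r : seq I) (F : I -> C) :
  (forall i, F i <> 0) -> \big[Cmult/RtoC 1]_(i <- r) F i <> 0.
Proof.
move=> h; elim/big_rec: _ => [|i x _ hx]; first exact: C1_nz.
by apply: Cmult_neq_0.
Qed.

Definition nonpole (s : C) : Prop := forall m : nat, s <> - RtoC (INR m).

Lemma nonpole_Re s : (0 < Re s)%R -> nonpole s.
Proof.
move=> h m e; move: h; rewrite e Re_opp /=; have := pos_INR m; lra.
Qed.

Lemma nonpole_add s m : nonpole s -> s + RtoC (INR m) <> 0.
Proof.
move=> h e; apply: (h m); apply: (Cplus_eq_reg_r (r := RtoC (INR m))).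
by rewrite e; ring.
Qed.

Lemma nonpole_neq0 s : nonpole s -> s <> 0.
Proof. by move=> h e; apply: (h 0%nat); rewrite e /= ; ring. Qed.

Lemma nonpole_succ s : nonpole s -> nonpole (s + 1).
Proof.
move=> h m e; apply: (h m.+1); rewrite S_INR RtoC_plus.
by apply: (Cplus_eq_reg_r (r := RtoC 1)); rewrite e; ring.
Qed.

Definition rising (s : C) (m : nat) : C := \big[Cmult/RtoC 1]_(k < m) (s + RtoC (INR k)).

Lemma rising_succ s m : rising s m.+1 = rising s m * (s + RtoC (INR m)).
Proof. by rewrite /rising big_ord_recr. Qed.

Lemma rising_neq0 s m : nonpole s -> rising s m <> 0.
Proof. by move=> hs; apply: Cprod_neq0 => k; apply: nonpole_add. Qed.

Lemma rising_shift s m : rising s m.+1 = s * rising (s + 1) m.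
Proof.
rewrite /rising big_ord_recl Cplus_0_r; congr Cmult; apply: eq_bigr => i _.
by rewrite lift0 S_INR RtoC_plus; ring.
Qed.

Definition gseq (s : C) (m : nat) : C :=
  RtoC (INR m`!) * Rcpow (INR m) s
    / rising s m.+1.

Lemma INR_fact_neq0 m : RtoC (INR m`!) <> 0.
Proof.
have h : (0 < INR m`!)%R by apply: lt_0_INR; apply/ltP/fact_gt0.
by move/RtoC_inj; lra.
Qed.

Lemma gseq_neq0 s m : nonpole s -> gseq s m <> 0.
Proof.
move=> h; apply: Cmult_neq_0.
  by apply: Cmult_neq_0; [apply: INR_fact_neq0 | apply: Rcpow_neq0].
exact: Cinv_neq0 (rising_neq0 h).
Qed.

Lemma gseq_succ s m : nonpole s -> (0 < m)%nat ->
  gseq s m.+1 = gseq s m * (Rcpow (1 + / INR m) s / (1 + s / RtoC (INR m.+1))).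
Proof.
move=> hs hm.
have hm0 : (0 < INR m)%R by apply: lt_0_INR; apply/ltP.
have hm1 : (0 < INR m.+1)%R by apply: lt_0_INR; lia.
have h1 : RtoC (INR m.+1) <> 0 by move/RtoC_inj; lra.
have h2 := nonpole_add (m := m.+1) hs.
have -> : Rcpow (1 + / INR m) s = Rcpow (INR m.+1) s / Rcpow (INR m) s.
  by rewrite -Rcpow_div //; congr Rcpow; rewrite S_INR; field; lra.
rewrite /gseq [X in _ / X]rising_succ factS mult_INR RtoC_mult.
have hp := @rising_neq0 s m.+1 hs.
have hr := @Rcpow_neq0 (INR m) s.
field; repeat split => //.
by move: h2; rewrite Cplus_comm.
Qed.

Lemma ln_succ_bounds (x : R) : (0 < x)%R -> (/ (x + 1) <= ln (1 + / x) <= / x)%R.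
Proof.
move=> hx; have hi := Rinv_0_lt_compat x hx.
have key y : (0 < y)%R -> (ln y <= y - 1)%R.
  move=> hy; case: (Req_dec y 1) => [->|hne]; first by rewrite ln_1; lra.
  apply: Rlt_le; rewrite -[X in (_ < X)%R]ln_exp; apply: ln_increasing => //.
  have := @exp_ineq1 (y - 1); rewrite (_ : (1 + (y - 1) = y)%R); last by ring.
  by apply; lra.
split.
- have h : (0 < 1 + / x)%R by lra.
  have := key _ (Rinv_0_lt_compat _ h); rewrite ln_Rinv //.
  rewrite (_ : (/ (1 + / x) - 1 = - / (x + 1))%R); first lra.
  by field; lra.
- by have := key (1 + / x)%R; lra.
Qed.

(** To first order in 1/m the numerator and the denominator of the ratio are
    both 1 + s/m, so only terms of order 1/m^2 survive in the difference. *)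
Lemma gseq_ratio_bound (s : C) (m : nat) : (0 < m)%nat ->
  (2 * Cmod s <= INR m.+1)%R ->
  (Cmod (Rcpow (1 + / INR m) s / (1 + s / RtoC (INR m.+1)) - 1)
    <= 2 * (Cmod s * (Cmod s * exp (Cmod s)) + Cmod s) / (INR m * INR m))%R.
Proof.
move=> hm hs.
have hm0 : (1 <= INR m)%R by apply: (le_INR 1); apply/leP.
have hm1 : (INR m.+1 = INR m + 1)%R by rewrite S_INR.
have h1 : RtoC (INR m.+1) <> 0 by move/RtoC_inj; lra.
set d := 1 + s / RtoC (INR m.+1).
set L := ln (1 + / INR m).
have hs0 := Cmod_ge_0 s.
have hd : (/ 2 <= Cmod d)%R.
  have := Cmod_triangle_rev 1 (- (s / RtoC (INR m.+1))).
  rewrite Cmod_1 Cmod_opp Cmod_div // Cmod_R Rabs_pos_eq; last lra.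
  rewrite (_ : 1 - - (s / RtoC (INR m.+1)) = d); last by rewrite /d; ring.
  have : (Cmod s / INR m.+1 <= / 2)%R.
    apply: (Rmult_le_reg_r (INR m.+1)); first lra.
    by rewrite /Rdiv Rmult_assoc Rinv_l; lra.
  by lra.
have hd0 : d <> 0 by apply/Cmod_gt_0; lra.
have [hL1 hL2] : (/ (INR m + 1) <= L <= / INR m)%R by apply: ln_succ_bounds; lra.
have hi : (0 < / (INR m + 1))%R by apply: Rinv_0_lt_compat; lra.
have hi1 : (/ INR m <= 1)%R by rewrite -Rinv_1; apply: Rinv_le_contravar; lra.
have hdec : Rcpow (1 + / INR m) s / d - 1 =
    ((Cexp (s * RtoC L) - 1 - s * RtoC L) + s * (RtoC L - RtoC (/ INR m.+1))) / d.
  have -> : Cexp (s * RtoC L) - 1 - s * RtoC L + s * (RtoC L - RtoC (/ INR m.+1)) =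
      Cexp (s * RtoC L) - d by rewrite /d RtoC_inv; [field | lra].
  by rewrite /Rcpow -/L; field.
have hsL : (Cmod (s * RtoC L) <= Cmod s * / INR m)%R.
  rewrite Cmod_mult Cmod_R Rabs_pos_eq; last lra.
  by apply: Rmult_le_compat_l.
have hm2 : (/ INR m * / INR m = / (INR m * INR m))%R by rewrite Rinv_mult.
have hA : (Cmod (Cexp (s * RtoC L) - 1 - s * RtoC L)
    <= Cmod s * (Cmod s * exp (Cmod s)) * / (INR m * INR m))%R.
  apply: Rle_trans (Cexp_minus1_order2 _) _.
  have h0 := Cmod_ge_0 (s * RtoC L).
  have he : (exp (Cmod (s * RtoC L)) <= exp (Cmod s))%R.
    apply: exp_monotone; apply: Rle_trans hsL _.
    by rewrite -[X in (_ <= X)%R]Rmult_1_r; apply: Rmult_le_compat_l.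
  have he0 := exp_pos (Cmod (s * RtoC L)).
  rewrite -hm2.
  apply: Rle_trans (_ : (Cmod s * / INR m) * ((Cmod s * / INR m) * exp (Cmod s)) <= _)%R;
    last by apply: Req_le; ring.
  apply: Rmult_le_compat => //; first by apply: Rmult_le_pos; lra.
  by apply: Rmult_le_compat => //; lra.
have hB : (Cmod (s * (RtoC L - RtoC (/ INR m.+1))) <= Cmod s * / (INR m * INR m))%R.
  rewrite Cmod_mult; apply: Rmult_le_compat_l => //.
  rewrite -RtoC_minus Cmod_R hm1 Rabs_pos_eq; last lra.
  apply: Rle_trans (_ : / INR m - / (INR m + 1) <= _)%R; first lra.
  rewrite (_ : (/ INR m - / (INR m + 1) = / (INR m * (INR m + 1)))%R);
    last by field; lra.
  by apply: Rinv_le_contravar; nra.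
rewrite hdec Cmod_div //.
have h3 := Cmod_triangle (Cexp (s * RtoC L) - 1 - s * RtoC L)
  (s * (RtoC L - RtoC (/ INR m.+1))).
apply: Rle_trans
  (_ : (Cmod s * (Cmod s * exp (Cmod s)) + Cmod s) * / (INR m * INR m) * 2 <= _)%R;
  last by apply: Req_le; rewrite /Rdiv; ring.
apply: Rmult_le_compat; [exact: Cmod_ge_0 | | lra | ].
  by apply/Rlt_le/Rinv_0_lt_compat; lra.
rewrite (_ : 2 = / / 2)%R; last by field.
by apply: Rinv_le_contravar; lra.
Qed.

Lemma is_lim_seq_inv_INR (K : R) : is_lim_seq (fun m => K / INR m)%R 0.
Proof.
apply: (is_lim_seq_div _ _ K p_infty 0) => //.
- exact: is_lim_seq_const.
- exact: is_lim_seq_INR.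
- by rewrite /is_Rbar_div /is_Rbar_mult /= Rmult_0_r.
Qed.

(** The ratios (1 + 1/m)^s / (1 + s/(m+1)) of consecutive terms of the
    Euler-Gauss sequence are 1 + O(1/m^2), and 1/m^2 telescopes up to a constant,
    so the sequence converges like an infinite product. *)
Lemma Gamma_lim s : nonpole s -> clim (gseq s) (Gamma s) /\ Gamma s <> 0.
Proof.
move=> hs.
(* One factor 2 comes from the bound on the ratios, the other one from
   1/m^2 <= 2 (1/m - 1/(m+1)). *)
set K := (4 * (Cmod s * (Cmod s * exp (Cmod s)) + Cmod s))%R.
have hs0 := Cmod_ge_0 s; have he := exp_pos (Cmod s).
have hK : (0 <= K)%R by rewrite /K; nra.
have [M hM] : exists M : nat, (2 * Cmod s + 2 * K + 1 <= INR M)%R.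
  have [M hM] := nfloor_ex (2 * Cmod s + 2 * K + 1) ltac:(lra).
  by exists M.+1; rewrite S_INR; lra.
have hM0 : (0 < M)%nat.
  by case: M hM => //=; lra.
have [|||||l [hl hl0]] := @clim_ratio (gseq s) (fun m => K / INR m)%R M.
- exact: gseq_neq0.
- apply: (Rmult_le_reg_r (INR M)); first lra.
  by rewrite /Rdiv Rmult_assoc Rinv_l; lra.
- move=> m; case: m => [|m]; first by rewrite /= /Rdiv Rinv_0; lra.
  apply: Rmult_le_pos => //; apply/Rlt_le/Rinv_0_lt_compat/lt_0_INR; lia.
- exact: is_lim_seq_inv_INR.
- move=> m hm.
  have hm0 : (0 < m)%nat by apply/ltP; move/ltP: hM0; lia.
  have hmM : (INR M <= INR m)%R by apply: le_INR.
  rewrite gseq_succ //.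
  set r := (_ / _)%C.
  rewrite (_ : gseq s m * r - gseq s m = gseq s m * (r - 1)); last by ring.
  rewrite Cmod_mult; apply: Rmult_le_compat_l; first exact: Cmod_ge_0.
  apply: Rle_trans (gseq_ratio_bound hm0 _) _; first by rewrite S_INR; lra.
  rewrite S_INR (_ : (K / INR m - K / (INR m + 1) = K / (INR m * (INR m + 1)))%R);
    last by field; lra.
  rewrite /K /Rdiv (_ : 4 = 2 * 2)%R; last by ring.
  rewrite !Rmult_assoc; apply: Rmult_le_compat_l; first lra.
  rewrite -[X in (_ <= X)%R]Rmult_assoc [(2 * _)%R]Rmult_comm Rmult_assoc.
  apply: Rmult_le_compat_l; first by nra.
  rewrite (_ : (2 * / (INR m * (INR m + 1)) = / ((INR m * (INR m + 1)) * / 2))%R);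
    last by field; lra.
  by apply: Rinv_le_contravar; nra.
by rewrite /Gamma (Clim_seq_eq hl).
Qed.

Lemma Gamma_neq0 s : nonpole s -> Gamma s <> 0.
Proof. by case/Gamma_lim. Qed.

Lemma clim_ratio_INR (z : C) :
  clim (fun m => RtoC (INR m) / (z + RtoC (INR m))) 1.
Proof.
have [M hM] : exists M : nat, (2 * Cmod z + 1 <= INR M)%R.
  have [M hM] := nfloor_ex (2 * Cmod z + 1) ltac:(have := Cmod_ge_0 z; lra).
  by exists M.+1; rewrite S_INR; lra.
apply: (@clim_squeeze _ _ (fun m => (2 * Cmod z) / INR m)%R M);
  last exact: is_lim_seq_inv_INR.
move=> m hm; have hmM : (INR M <= INR m)%R by apply: le_INR.
have hz := Cmod_ge_0 z.
have hd : (INR m / 2 <= Cmod (z + RtoC (INR m)))%R.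
  have := Cmod_triangle_rev (RtoC (INR m)) (- z).
  rewrite Cmod_opp Cmod_R Rabs_pos_eq; last lra.
  by rewrite (_ : RtoC (INR m) - - z = z + RtoC (INR m)); [lra | ring].
have hd0 : z + RtoC (INR m) <> 0 by apply/Cmod_gt_0; lra.
rewrite (_ : _ - 1 = - z / (z + RtoC (INR m))); last by field.
rewrite Cmod_div // Cmod_opp /Rdiv Rmult_assoc (Rmult_comm 2) Rmult_assoc.
apply: Rmult_le_compat_l => //.
rewrite (_ : (/ INR m * 2 = / (INR m / 2))%R); last by field; lra.
by apply: Rinv_le_contravar; lra.
Qed.

(** The two products differ only in their first and last factors. *)
Lemma gseq_shift s m : nonpole s -> (0 < m)%nat ->
  gseq (s + 1) m = gseq s m * (s * (RtoC (INR m) / (s + 1 + RtoC (INR m)))).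
Proof.
move=> hs hm.
have hm0 : (0 < INR m)%R by apply: lt_0_INR; apply/ltP.
rewrite /gseq Rcpow_plus Rcpow_1 //.
have hp := @rising_neq0 s m.+1 hs.
have e : s * rising (s + 1) m.+1 = rising s m.+1 * (s + 1 + RtoC (INR m)).
  by rewrite -rising_shift rising_succ S_INR RtoC_plus; congr Cmult; ring.
have h0 : s + 1 + RtoC (INR m) <> 0 by apply: nonpole_add; apply: nonpole_succ.
have hs0 := nonpole_neq0 hs.
have -> : rising (s + 1) m.+1 = rising s m.+1 * (s + 1 + RtoC (INR m)) / s.
  by rewrite -e; field.
by field.
Qed.

Lemma Gamma_succ s : nonpole s -> Gamma (s + 1) = s * Gamma s.
Proof.
move=> hs.
have [h _] := Gamma_lim hs; have [h1 _] := Gamma_lim (nonpole_succ hs).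
apply: (clim_unique h1).
apply: (@clim_ext_loc
  (fun m => gseq s m * (s * (RtoC (INR m) / (s + 1 + RtoC (INR m))))) _ _ 1).
  by move=> m hm; rewrite gseq_shift //; apply/ltP; lia.
rewrite (_ : s * Gamma s = Gamma s * (s * 1)); last by ring.
apply: clim_mult => //; apply: clim_mult; first exact: clim_const.
exact: clim_ratio_INR.
Qed.

Lemma nonpole_plus_nat s k : nonpole s -> nonpole (s + RtoC (INR k)).
Proof.
move=> hs; elim: k => [|k IH]; first by rewrite Cplus_0_r.
by rewrite S_INR RtoC_plus Cplus_assoc; apply: nonpole_succ.
Qed.

Lemma Gamma_one_plus_nat k : Gamma (1 + RtoC (INR k)) = RtoC (INR k`!) * Gamma 1.
Proof.
have h1 : nonpole 1 by apply: nonpole_Re => /=; lra.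
elim: k => [|k IH]; first by rewrite Cplus_0_r fact0 Cmult_1_l.
rewrite {1}S_INR RtoC_plus Cplus_assoc Gamma_succ; last exact: nonpole_plus_nat.
by rewrite IH factS mult_INR RtoC_mult S_INR RtoC_plus; ring.
Qed.

(** * Integrals of complex functions of a real variable *)

Local Notation is_CInt := (is_RInt (V := C_R_NormedModule)).
Local Notation is_CInt_gen := (is_RInt_gen (V := C_R_NormedModule)).

Lemma is_CInt_of_ReIm f u v (l : C) :
  is_RInt (fun x => Re (f x)) u v (Re l) -> is_RInt (fun x => Im (f x)) u v (Im l) ->
  is_CInt f u v l.
Proof. by case: l => a b h1 h2; apply: is_RInt_fct_extend_pair. Qed.

Lemma is_CInt_Re f u v (l : C) : is_CInt f u v l ->
  is_RInt (fun x => Re (f x)) u v (Re l).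
Proof. exact: is_RInt_fct_extend_fst. Qed.

Lemma is_CInt_Im f u v (l : C) : is_CInt f u v l ->
  is_RInt (fun x => Im (f x)) u v (Im l).
Proof. exact: is_RInt_fct_extend_snd. Qed.

Lemma is_CInt_scal (c : C) f u v (l : C) : is_CInt f u v l ->
  is_CInt (fun x => c * f x) u v (c * l).
Proof.
move=> h; have h1 := is_CInt_Re h; have h2 := is_CInt_Im h.
apply: is_CInt_of_ReIm.
- by apply: (is_RInt_minus (fun x => Re c * Re (f x))%R (fun x => Im c * Im (f x))%R);
  apply: is_RInt_scal.
- by apply: (is_RInt_plus (fun x => Re c * Im (f x))%R (fun x => Im c * Re (f x))%R);
  apply: is_RInt_scal.
Qed.

Lemma is_CInt_ext (f g : R -> C) (u v : R) (l : C) : (u <= v)%R ->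
  (forall x, (u < x < v)%R -> f x = g x) -> is_CInt f u v l -> is_CInt g u v l.
Proof.
move=> huv h; apply: is_RInt_ext => x.
by rewrite Rmin_left // Rmax_right //; apply: h.
Qed.

Lemma is_CInt_derive (F f : R -> C) (u v : R) : (u <= v)%R ->
  (forall t, u <= t <= v -> cderiv F t (f t))%R ->
  (forall t, u <= t <= v -> ccont f t)%R ->
  is_CInt f u v (F v - F u).
Proof.
move=> huv hd hc.
apply: is_CInt_of_ReIm.
- apply: (is_RInt_derive (V := R_CompleteNormedModule) (fun x => Re (F x))) => x;
    rewrite Rmin_left // Rmax_right // => hx; first by case: (hd x hx).
  by case: (hc x hx).
- apply: (is_RInt_derive (V := R_CompleteNormedModule) (fun x => Im (F x))) => x;
    rewrite Rmin_left // Rmax_right // => hx; first by case: (hd x hx).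
  by case: (hc x hx).
Qed.

Lemma ex_CInt_ccont (f : R -> C) (u v : R) : (u <= v)%R ->
  (forall t, u <= t <= v -> ccont f t)%R -> exists l, is_CInt f u v l.
Proof.
move=> huv hc.
have [l1 h1] : ex_RInt (fun x => Re (f x)) u v.
  by apply: ex_RInt_continuous => x; rewrite Rmin_left // Rmax_right // => /hc [].
have [l2 h2] : ex_RInt (fun x => Im (f x)) u v.
  by apply: ex_RInt_continuous => x; rewrite Rmin_left // Rmax_right // => /hc [].
by exists (l1, l2); apply: is_CInt_of_ReIm.
Qed.

Lemma is_CInt_norm (f : R -> C) (g : R -> R) (u v : R) (l : C) (m : R) : (u <= v)%R ->
  (forall x, u <= x <= v -> Cmod (f x) <= g x)%R ->
  is_CInt f u v l -> is_RInt g u v m -> (Cmod l <= m)%R.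
Proof.
move=> huv h h1 h2; rewrite Cmod_norm.
apply: (norm_RInt_le (V := C_R_NormedModule) f g u v) => // x hx.
by rewrite -[norm _]Cmod_norm; apply: h.
Qed.

Lemma ball_of_Cmod (l z : C) (eps : R) :
  (Cmod (z - l) < eps)%R -> @ball C_R_NormedModule l eps z.
Proof.
move=> h; split.
- by apply: Rle_lt_trans h; apply: (re_le_Cmod (z - l)).
- by apply: Rle_lt_trans h; apply: (Im_le_Cmod (z - l)).
Qed.

Lemma Cmod_of_ball (l z : C) (eps : R) :
  @ball C_R_NormedModule l (eps / 2) z -> (Cmod (z - l) < eps)%R.
Proof.
case=> h1 h2; apply: Rle_lt_trans (Cmod_le_ReIm _) _.
have {}h1 : (Rabs (Re (z - l)) < eps / 2)%R by [].
have {}h2 : (Rabs (Im (z - l)) < eps / 2)%R by [].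
by lra.
Qed.

Section Gen.
Variables (Fa Fb : (R -> Prop) -> Prop).
Context {FFa : ProperFilter Fa} {FFb : ProperFilter Fb}.

Lemma is_CInt_gen_eps (f : R -> C) (l : C) :
  is_CInt_gen f Fa Fb l <->
  (forall eps, (0 < eps)%R -> filter_prod Fa Fb (fun ab =>
     exists z, is_CInt f ab.1 ab.2 z /\ Cmod (z - l) < eps)%R).
Proof.
split.
- move=> h eps he.
  have he2 : (0 < eps / 2)%R by lra.
  have /(filterlimi_locally (U := C_R_NormedModule)) := h.
  move=> /(_ (mkposreal _ he2)); apply: filter_imp => ab [z [h1 h2]].
  by exists z; split => //; apply: Cmod_of_ball.
- move=> h; apply/(filterlimi_locally (U := C_R_NormedModule)) => eps.
  have := h eps (cond_pos eps); apply: filter_imp => ab [z [h1 h2]].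
  by exists z; split => //; apply: ball_of_Cmod.
Qed.

Lemma is_CInt_gen_Re f (l : C) : is_CInt_gen f Fa Fb l ->
  is_RInt_gen (fun x => Re (f x)) Fa Fb (Re l).
Proof.
move/is_CInt_gen_eps => h.
apply/(filterlimi_locally (U := R_NormedModule)) => eps.
have := h eps (cond_pos eps); apply: filter_imp => ab [z [h1 h2]].
exists (Re z); split; first exact: is_CInt_Re.
by apply: Rle_lt_trans h2; apply: (re_le_Cmod (z - l)).
Qed.

Lemma is_CInt_gen_of_ReIm f (l : C) :
  is_RInt_gen (fun x => Re (f x)) Fa Fb (Re l) ->
  is_RInt_gen (fun x => Im (f x)) Fa Fb (Im l) -> is_CInt_gen f Fa Fb l.
Proof.
move=> /(filterlimi_locally (U := R_NormedModule)) h1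
  /(filterlimi_locally (U := R_NormedModule)) h2.
apply/(filterlimi_locally (U := C_R_NormedModule)) => eps.
apply: (filter_imp _ _ _ (filter_and _ _ (h1 eps) (h2 eps))) => ab [[x [hx hx']] [y [hy hy']]].
by exists (x, y); split; [apply: is_CInt_of_ReIm | split].
Qed.

Lemma is_CInt_gen_scal (c : C) f (l : C) : is_CInt_gen f Fa Fb l ->
  is_CInt_gen (fun x => c * f x) Fa Fb (c * l).
Proof.
move/is_CInt_gen_eps => h; apply/is_CInt_gen_eps => eps he.
have hc := Cmod_ge_0 c.
have he' : (0 < eps / (Cmod c + 1))%R by apply: Rdiv_lt_0_compat; lra.
have := h _ he'; apply: filter_imp => ab [z [h1 h2]].
exists (c * z); split; first exact: is_CInt_scal.
rewrite (_ : c * z - c * l = c * (z - l)); last by ring.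
rewrite Cmod_mult.
have : (Cmod c * Cmod (z - l) <= Cmod c * (eps / (Cmod c + 1)))%R.
  by apply: Rmult_le_compat_l; lra.
have -> : (Cmod c * (eps / (Cmod c + 1)) = eps - eps / (Cmod c + 1))%R.
  by field; lra.
by lra.
Qed.

Lemma is_CInt_gen_plus f g (l m : C) : is_CInt_gen f Fa Fb l ->
  is_CInt_gen g Fa Fb m -> is_CInt_gen (fun x => f x + g x) Fa Fb (l + m).
Proof. exact: (is_RInt_gen_plus (V := C_R_NormedModule)). Qed.

Lemma is_CInt_gen_norm (f : R -> C) (g : R -> R) (l : C) (m : R) :
  filter_prod Fa Fb (fun ab => ab.1 <= ab.2)%R ->
  filter_prod Fa Fb (fun ab => forall x, ab.1 <= x <= ab.2 -> Cmod (f x) <= g x)%R ->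
  is_CInt_gen f Fa Fb l -> is_RInt_gen g Fa Fb m -> (Cmod l <= m)%R.
Proof.
move=> h1 h2 h3 h4; rewrite Cmod_norm.
apply: (RInt_gen_norm (V := C_R_CompleteNormedModule) f g l m h1 _ h3 h4).
apply: filter_imp h2 => ab h x hx.
by rewrite -[norm _]Cmod_norm; apply: h.
Qed.

End Gen.

(** * The beta integral *)

Lemma near01 (P : R * R -> Prop) :
  (forall u v, 0 < u -> u <= v -> v < 1 -> P (u, v))%R ->
  filter_prod (at_right 0) (at_left 1) P.
Proof.
move=> h.
have h2 : (0 < / 2)%R by lra.
apply: (Filter_prod _ _ _ (fun u => 0 < u < / 2)%R (fun v => / 2 < v < 1)%R).
- exists (mkposreal _ h2) => y hy hy0; split => //.
  by move: hy; rewrite /ball /= /AbsRing_ball /abs /minus /plus /opp /= => /Rabs_def2; lra.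
- exists (mkposreal _ h2) => y hy hy0; split => //.
  by move: hy; rewrite /ball /= /AbsRing_ball /abs /minus /plus /opp /= => /Rabs_def2; lra.
- by move=> u v hu hv; apply: h; lra.
Qed.

Lemma is_CInt_gen_ext01 (f g : R -> C) (l : C) :
  (forall x, (0 < x < 1)%R -> f x = g x) ->
  is_CInt_gen f (at_right 0) (at_left 1) l -> is_CInt_gen g (at_right 0) (at_left 1) l.
Proof.
move=> h; apply: is_RInt_gen_ext; apply: near01 => u v hu huv hv x /=.
by rewrite Rmin_left // Rmax_right // => hx; apply: h; lra.
Qed.

Definition ctends (F : (R -> Prop) -> Prop) (f : R -> C) (l : C) : Prop :=
  forall eps, (0 < eps)%R -> F (fun x => Cmod (f x - l) < eps)%R.

Lemma is_CInt_gen_derive01 (F f : R -> C) (A B : C) :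
  (forall t, 0 < t < 1 -> cderiv F t (f t))%R ->
  (forall t, 0 < t < 1 -> ccont f t)%R ->
  ctends (at_right 0) F A -> ctends (at_left 1) F B ->
  is_CInt_gen f (at_right 0) (at_left 1) (B - A).
Proof.
move=> hd hc hA hB; apply/is_CInt_gen_eps => eps he.
have he2 : (0 < eps / 2)%R by lra.
have h01 : filter_prod (at_right 0) (at_left 1)
    (fun ab : R * R => 0 < ab.1 /\ ab.1 <= ab.2 /\ ab.2 < 1)%R.
  by apply: near01.
have h1 : filter_prod (at_right 0) (at_left 1)
    (fun ab : R * R => Cmod (F ab.1 - A) < eps / 2 /\ Cmod (F ab.2 - B) < eps / 2)%R.
  by apply: (Filter_prod _ _ _ _ _ (hA _ he2) (hB _ he2)).
apply: (filter_imp _ _ _ (filter_and _ _ h01 h1)) => -[u v] /= [[hu [huv hv]] [h2 h3]].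
exists (F v - F u); split.
  by apply: is_CInt_derive => // t ht; [apply: hd | apply: hc]; lra.
rewrite (_ : F v - F u - (B - A) = (F v - B) + - (F u - A)); last by ring.
by apply: Rle_lt_trans (Cmod_triangle _ _) _; rewrite Cmod_opp; lra.
Qed.

Lemma Rcpow_tends_0 (s : C) : (0 < Re s)%R -> ctends (at_right 0) (fun t => Rcpow t s) 0.
Proof.
move=> hs eps he.
have h := is_lim_ln_0 (fun y => y < ln eps / Re s)%R.
have {}h := h (ex_intro _ (ln eps / Re s)%R (fun x hx => hx)).
apply: (filter_imp (F := at_right 0) (fun t => ln t < ln eps / Re s)%R _ _ h) => t ht.
rewrite (_ : Rcpow t s - 0 = Rcpow t s); last by ring.
rewrite Cmod_Rcpow -(exp_ln eps) //; apply: exp_increasing.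
rewrite (_ : ln eps = Re s * (ln eps / Re s))%R; last by field; lra.
by apply: Rmult_lt_compat_l.
Qed.

Lemma at_left_of_right (P : R -> Prop) :
  at_right 0 (fun t => P (1 - t)%R) -> at_left 1 P.
Proof.
case=> e he.
suff h (y : R) : (Rabs (y - 1) < e -> y < 1 -> P y)%R by exists e.
move=> hy hy1; rewrite (_ : y = 1 - (1 - y))%R; last by ring.
apply: he; last lra.
change (Rabs (1 - y - 0) < e)%R.
by rewrite Rminus_0_r Rabs_minus_sym.
Qed.

Lemma near_right0_lt1 : at_right 0 (fun t => 0 < t < 1)%R.
Proof.
have h1 : (0 < 1)%R by lra.
exists (mkposreal _ h1) => y hy hy0; split => //.
by move: hy; rewrite /ball /= /AbsRing_ball /abs /minus /plus /opp /= => /Rabs_def2; lra.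
Qed.

Definition betaf (s w : C) (t : R) : C := Rcpow t (s - 1) * Rcpow (1 - t) (w - 1).

Definition is_beta (s w l : C) : Prop :=
  is_CInt_gen (betaf s w) (at_right 0) (at_left 1) l.

Lemma ccont_Rcpow s (t : R) : (0 < t)%R -> ccont (fun x => Rcpow x s) t.
Proof. by move=> ht; apply: cderiv_ccont (cderiv_Rcpow s ht). Qed.

Lemma ccont_betaf s w (t : R) : (0 < t < 1)%R -> ccont (betaf s w) t.
Proof.
move=> ht; apply: ccont_mult; first by apply: ccont_Rcpow; lra.
have h1 : (t < 1)%R by lra.
exact: cderiv_ccont (cderiv_Rcpow_1m (w - 1) h1).
Qed.

Lemma Cmod_Rcpow_le1 t s : (0 < t <= 1)%R -> (0 <= Re s)%R -> (Cmod (Rcpow t s) <= 1)%R.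
Proof.
move=> ht hs; rewrite Cmod_Rcpow -exp_0; apply: exp_monotone.
have hl : (ln t <= 0)%R.
  by rewrite -ln_1; case: (Req_dec t 1) => [->|hne]; [lra | apply/Rlt_le/ln_increasing; lra].
by nra.
Qed.

(** Near either end one factor tends to 0 while the other one stays bounded by 1;
    these are the boundary terms in the integration by parts below. *)
Lemma beta_boundary s w : (0 < Re s)%R -> (0 < Re w)%R ->
  ctends (at_right 0) (fun t => Rcpow t s * Rcpow (1 - t) w) 0 /\
  ctends (at_left 1) (fun t => Rcpow t s * Rcpow (1 - t) w) 0.
Proof.
have key s' w' : (0 < Re s')%R -> (0 < Re w')%R ->
    ctends (at_right 0) (fun t => Rcpow t s' * Rcpow (1 - t) w') 0.
  move=> hs hw eps he.
  apply: (filter_imp _ _ _ (filter_and _ _ near_right0_lt1 (Rcpow_tends_0 hs he))) => t [ht h].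
  move: h; rewrite (_ : Rcpow t s' - 0 = Rcpow t s'); last by ring.
  rewrite (_ : forall z : C, z - 0 = z); last by move=> z; ring.
  move=> h; rewrite Cmod_mult.
  have h1 : (Cmod (Rcpow (1 - t) w') <= 1)%R by apply: Cmod_Rcpow_le1; lra.
  have := Cmod_ge_0 (Rcpow t s'); have := Cmod_ge_0 (Rcpow (1 - t) w').
  by nra.
move=> hs hw; split; first exact: key.
move=> eps he; apply: at_left_of_right.
have := key w s hw hs eps he; apply: filter_imp => t.
by rewrite (_ : (1 - (1 - t) = t)%R) 1?Cmult_comm //; ring.
Qed.

Lemma betaf_succl s w t : (0 < t)%R -> betaf (s + 1) w t = RtoC t * betaf s w t.
Proof.
move=> ht; rewrite /betaf (_ : s + 1 - 1 = (s - 1) + 1); last by ring.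
by rewrite Rcpow_plus Rcpow_1 //; ring.
Qed.

Lemma betaf_succr s w t : (t < 1)%R -> betaf s (w + 1) t = RtoC (1 - t) * betaf s w t.
Proof.
move=> ht; rewrite /betaf (_ : w + 1 - 1 = (w - 1) + 1); last by ring.
by rewrite Rcpow_plus Rcpow_1; [ring | lra].
Qed.

(** The integrand is the derivative of t^s (1-t)^w, whose boundary values are 0.
    Together with 1 = t + (1-t) this one identity yields every recurrence of the
    beta integral. *)
Lemma beta_parts s w : (0 < Re s)%R -> (0 < Re w)%R ->
  is_CInt_gen (fun t => (s * RtoC (1 - t) - w * RtoC t) * betaf s w t)
    (at_right 0) (at_left 1) (RtoC 0).
Proof.
move=> hs hw; have [h0 h1] := beta_boundary hs hw.
have := @is_CInt_gen_derive01 _ (fun t => (s * RtoC (1 - t) - w * RtoC t) * betaf s w t)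
  _ _ _ _ h0 h1.
rewrite (_ : 0 - 0 = 0); last by ring.
apply=> t ht.
- have ht1 : (t < 1)%R by lra.
  have ht0 : (0 < t)%R by lra.
  have := cderiv_mult (cderiv_Rcpow s ht0) (cderiv_Rcpow_1m w ht1).
  rewrite (_ : _ + _ = (s * RtoC (1 - t) - w * RtoC t) * betaf s w t) //.
  rewrite /betaf.
  have e x z : (0 < x)%R -> Rcpow x z = Rcpow x (z - 1) * RtoC x.
    move=> hx; rewrite -(Rcpow_1 hx) -Rcpow_plus; congr Rcpow; ring.
  by rewrite (e t s) // (e (1 - t)%R w); [ring | lra].
- apply: ccont_mult; last exact: ccont_betaf.
  have hlin (k m : R) : continuous (fun x => k + m * x)%R t.
    apply: (ex_derive_continuous (V := R_NormedModule)); by auto_derive.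
  split.
  + apply: (continuous_ext (fun x => Re s + (- Re s - Re w) * x)%R) => //.
    by move=> x; rewrite Re_minus !Re_mult /=; ring.
  + apply: (continuous_ext (fun x => Im s + (- Im s - Im w) * x)%R) => //.
    by move=> x; rewrite Im_minus !Im_mult /=; ring.
Qed.

(** The recurrences that lower an argument transport the existence of the
    integral from larger exponents, where the integrand is continuous up to the
    ends, to all exponents of positive real part. *)
Lemma beta_pred_l s w (l : C) : (0 < Re s)%R -> (0 < Re w)%R ->
  is_beta (s + 1) w l -> is_beta s w ((s + w) / s * l).
Proof.
move=> hs hw h; have hs0 := Cneq0_Re hs.
pose proof (is_CInt_gen_scal (c := / s) (is_CInt_gen_plus (beta_parts hs hw)
  (is_CInt_gen_scal (c := s + w) h))) as hq; move: hq.
rewrite (_ : / s * (0 + (s + w) * l) = (s + w) / s * l); last by field.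
apply: is_CInt_gen_ext01 => t ht.
rewrite betaf_succl; last lra.
by rewrite RtoC_minus; field.
Qed.

Lemma beta_pred_r s w (l : C) : (0 < Re s)%R -> (0 < Re w)%R ->
  is_beta s (w + 1) l -> is_beta s w ((s + w) / w * l).
Proof.
move=> hs hw h; have hw0 := Cneq0_Re hw.
pose proof (is_CInt_gen_scal (c := / w) (is_CInt_gen_plus
  (is_CInt_gen_scal (c := - (1)) (beta_parts hs hw))
  (is_CInt_gen_scal (c := s + w) h))) as hq; move: hq.
rewrite (_ : / w * (- (1) * 0 + (s + w) * l) = (s + w) / w * l); last by field.
apply: is_CInt_gen_ext01 => t ht.
rewrite betaf_succr; last lra.
by rewrite RtoC_minus; field.
Qed.

Lemma beta_succ_r s w (l : C) : (0 < Re s)%R -> (0 < Re w)%R ->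
  is_beta s w l -> is_beta s (w + 1) (w / (s + w) * l).
Proof.
move=> hs hw h.
have hsw : s + w <> 0 by apply: Cneq0_Re; rewrite Re_plus; lra.
pose proof (is_CInt_gen_scal (c := / (s + w)) (is_CInt_gen_plus (beta_parts hs hw)
  (is_CInt_gen_scal (c := w) h))) as hq; move: hq.
rewrite (_ : / (s + w) * (0 + w * l) = w / (s + w) * l); last by field.
apply: is_CInt_gen_ext01 => t ht.
rewrite betaf_succr; last lra.
by rewrite RtoC_minus; field.
Qed.

(** A function continuous on the open interval and vanishing at both ends
    extends to a continuous function on the line, so its improper integral is an
    ordinary one. *)
Lemma ex_RInt_gen01 (f : R -> R) :
  (forall t, 0 < t < 1 -> continuous f t)%R ->
  filterlim f (at_right 0) (locally 0%R) -> filterlim f (at_left 1) (locally 0%R) ->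
  exists l : R, is_RInt_gen f (at_right 0) (at_left 1) l.
Proof.
move=> hc h0 h1.
have [g [hg [hfg _]]] := @C0_extension_lt R_UniformSpace f 0%R 0%R 0%R 1%R Rlt_0_1 hc h0 h1.
have hex u v : is_RInt g u v (RInt g u v).
  by apply: RInt_correct; apply: ex_RInt_continuous => z _; apply: hg.
exists (RInt g 0 1).
apply: (is_RInt_gen_ext g).
  apply: near01 => u v hu huv hv x /=.
  by rewrite Rmin_left // Rmax_right // => hx; apply: hfg; lra.
pose proof (@continuous_RInt R_NormedModule g 0 1 (fun u v => RInt g u v)
  (filter_forall _ (fun z => hex z.1 z.2))) as hcont.
apply/(filterlimi_locally (U := R_NormedModule)) => eps.
have [e he] := proj1 (filterlim_locally (U := R_NormedModule) _ _) hcont eps.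
apply: (Filter_prod _ _ _ (fun u => ball 0%R e u) (fun v => ball 1%R e v)).
- by exists e => y hy _.
- by exists e => y hy _.
- move=> u v hu hv; exists (RInt g u v); split; first exact: hex.
  exact: (he (u, v) (conj hu hv)).
Qed.

Lemma ctends_ReIm F (FF : Filter F) f (l : C) : ctends F f l ->
  filterlim (fun x => Re (f x)) F (locally (Re l)) /\
  filterlim (fun x => Im (f x)) F (locally (Im l)).
Proof.
move=> h; split; apply/(filterlim_locally (U := R_UniformSpace)) => eps;
  apply: (filter_imp _ _ _ (h eps (cond_pos eps))) => x hx;
  apply: Rle_lt_trans hx.
- exact: (re_le_Cmod (f x - l)).
- exact: (Im_le_Cmod (f x - l)).
Qed.

Lemma ex_beta s w : (0 < Re s)%R -> (0 < Re w)%R -> exists l, is_beta s w l.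
Proof.
move=> hs hw.
suff [l hl] : exists l, is_beta (s + 1) (w + 1) l.
  have hw1 : (0 < Re (w + 1))%R by rewrite Re_plus /=; lra.
  eexists; apply: beta_pred_r => //; apply: beta_pred_l => //; exact: hl.
have [h0 h1] := beta_boundary hs hw.
have e : betaf (s + 1) (w + 1) = fun t => Rcpow t s * Rcpow (1 - t) w.
  rewrite /betaf (_ : s + 1 - 1 = s); last by ring.
  by rewrite (_ : w + 1 - 1 = w) //; ring.
rewrite /is_beta e.
have hc t : (0 < t < 1)%R -> ccont (fun t => Rcpow t s * Rcpow (1 - t) w) t.
  by move=> ht; rewrite -e; apply: ccont_betaf.
have [a0 b0] := ctends_ReIm _ h0; have [a1 b1] := ctends_ReIm _ h1.
have [x hx] := ex_RInt_gen01 (fun t ht => (hc t ht).1) a0 a1.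
have [y hy] := ex_RInt_gen01 (fun t ht => (hc t ht).2) b0 b1.
by exists (x, y); apply: is_CInt_gen_of_ReIm.
Qed.

Lemma beta_plus_nat s w m (l : C) : (0 < Re s)%R -> (0 < Re w)%R ->
  is_beta s w l -> is_beta s (w + RtoC (INR m)) (l * (rising w m / rising (s + w) m)).
Proof.
move=> hs hw h.
have hsw : (0 < Re (s + w))%R by rewrite Re_plus; lra.
elim: m => [|m IH].
  by rewrite /rising !big_ord0 Cplus_0_r (_ : l * (1 / 1) = l) //; field.
have hm := pos_INR m.
have hwm : (0 < Re (w + RtoC (INR m)))%R by rewrite Re_plus /=; lra.
have := beta_succ_r hs hwm IH.
rewrite -Cplus_assoc -RtoC_plus -S_INR !rising_succ.
rewrite (_ : (w + RtoC (INR m)) / (s + (w + RtoC (INR m))) *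
    (l * (rising w m / rising (s + w) m)) =
  l * (rising w m * (w + RtoC (INR m)) /
    (rising (s + w) m * (s + w + RtoC (INR m))))) //.
have := @rising_neq0 (s + w) m (nonpole_Re hsw).
have h2 : s + w + RtoC (INR m) <> 0 by apply: nonpole_add; apply: nonpole_Re.
by move=> h3; field; split => //; rewrite Cplus_assoc.
Qed.

(** The recurrence in the second argument starts from B(s, 1) = 1/s, the integral
    of a power. *)
Lemma beta_nat s m : (0 < Re s)%R ->
  is_beta s (RtoC (INR m.+1)) (RtoC (INR m`!) / rising s m.+1).
Proof.
move=> hs; have hs0 := Cneq0_Re hs.
have h1 : is_beta s 1 (/ s).
  have hT : ctends (at_left 1) (fun t => / s * Rcpow t s) (/ s).
    move=> eps he.
    have [h2 h3] := ccont_mult (ccont_const (/ s) 1) (@ccont_Rcpow s 1 Rlt_0_1).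
    have he2 : (0 < eps / 2)%R by lra.
    pose proof (proj1 (filterlim_locally (U := R_UniformSpace) _ _) h2 (mkposreal _ he2)) as h2'.
    pose proof (proj1 (filterlim_locally (U := R_UniformSpace) _ _) h3 (mkposreal _ he2)) as h3'.
    have h4 : at_left 1 (fun t => Cmod (/ s * Rcpow t s - / s * Rcpow 1 s) < eps)%R.
      apply: filter_le_within; apply: (filter_imp _ _ _ (filter_and _ _ h2' h3')) => t [a b].
      apply: Cmod_of_ball; split; [exact: a | exact: b].
    by move: h4; rewrite Rcpow_base1 Cmult_1_r.
  have h0 : ctends (at_right 0) (fun t => / s * Rcpow t s) 0.
    move=> eps he.
    have hp : (0 < Cmod (/ s))%R by apply/Cmod_gt_0/Cinv_neq0.
    have he2 : (0 < eps / Cmod (/ s))%R by apply: Rdiv_lt_0_compat.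
    apply: (filter_imp _ _ _ (Rcpow_tends_0 hs he2)) => t ht.
    rewrite (_ : / s * Rcpow t s - 0 = / s * (Rcpow t s - 0)); last by ring.
    rewrite Cmod_mult (_ : eps = (Cmod (/ s) * (eps / Cmod (/ s))))%R; last by field; lra.
    exact: Rmult_lt_compat_l.
  have := @is_CInt_gen_derive01 (fun t => / s * Rcpow t s) (betaf s 1) _ _ _ _ h0 hT.
  rewrite (_ : / s - 0 = / s); last by ring.
  apply=> t ht; last exact: ccont_betaf.
  have hz : cderiv (fun=> / s) t 0.
    by split; apply: is_derive_const.
  have ht0 : (0 < t)%R by lra.
  have := cderiv_mult hz (cderiv_Rcpow s ht0).
  rewrite (_ : _ + _ = betaf s 1 t) // /betaf.
  by rewrite (_ : 1 - 1 = 0); [rewrite Rcpow_0; field | ring].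
have := @beta_plus_nat s 1 m _ hs Rlt_0_1 h1.
have hr : forall k, rising 1 k = RtoC (INR k`!).
  elim=> [|k IH]; first by rewrite /rising big_ord0.
  by rewrite rising_succ IH factS mult_INR RtoC_mult S_INR RtoC_plus; ring.
rewrite hr rising_shift (_ : 1 + RtoC (INR m) = RtoC (INR m.+1)); last first.
  by rewrite S_INR RtoC_plus; ring.
rewrite (_ : / s * (RtoC (INR m`!) / rising (s + 1) m) =
  RtoC (INR m`!) / (s * rising (s + 1) m)) //.
have := @rising_neq0 (s + 1) m (nonpole_succ (nonpole_Re hs)).
by move=> h; field.
Qed.

Lemma neg_ln_1m_le (t : R) : (0 < t < 1)%R -> (0 <= - ln (1 - t) <= t / (1 - t))%R.
Proof.
move=> ht.
have h : (0 < (1 - t) / t)%R by apply: Rdiv_lt_0_compat; lra.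
have := ln_succ_bounds h.
rewrite (_ : (1 + / ((1 - t) / t) = / (1 - t))%R); last by field; lra.
rewrite (_ : (/ ((1 - t) / t + 1) = t)%R); last by field; lra.
rewrite (_ : (/ ((1 - t) / t) = t / (1 - t))%R); last by field; lra.
by rewrite ln_Rinv; lra.
Qed.

(** |(1-t)^w - 1| <= |w| |ln (1-t)| <= |w| t / (1-t): the factor t raises the
    first exponent by one at the cost of one power of 1-t. *)
Lemma betaf_shift_bound (s w : C) (m : nat) (t : R) : (0 <= Re w)%R -> (0 < t < 1)%R ->
  (Cmod (betaf s (w + RtoC (INR m.+1)) t - betaf s (RtoC (INR m.+1)) t)
    <= Cmod w * Re (betaf (RtoC (Re s) + 1) (RtoC (INR m)) t))%R.
Proof.
move=> hw ht.
have hl := neg_ln_1m_le ht.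
set M := RtoC (INR m.+1).
have -> : betaf s (w + M) t - betaf s M t =
    Rcpow t (s - 1) * Rcpow (1 - t) (M - 1) * (Rcpow (1 - t) w - 1).
  rewrite /betaf (_ : w + M - 1 = (M - 1) + w); last by ring.
  by rewrite Rcpow_plus; ring.
rewrite !Cmod_mult !Cmod_Rcpow.
have h1 : (Cmod (Rcpow (1 - t) w - 1) <= Cmod w * (t / (1 - t)))%R.
  apply: Rle_trans (Cexp_minus1_le _) _.
    by rewrite Re_mult /= Rmult_0_r; nra.
  rewrite Cmod_mult Cmod_R -Rabs_Ropp Rabs_pos_eq; last lra.
  by apply: Rmult_le_compat_l; [apply: Cmod_ge_0 | lra].
have -> : Re (betaf (RtoC (Re s) + 1) (RtoC (INR m)) t) =
    (exp (Re (s - 1) * ln t) * t * (exp (Re (M - 1) * ln (1 - t)) / (1 - t)))%R.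
  rewrite /betaf (_ : RtoC (Re s) + 1 - 1 = RtoC (Re s)); last by ring.
  rewrite -RtoC_minus !Rcpow_real -RtoC_mult re_RtoC.
  congr Rmult.
  - rewrite -[X in _ = (_ * X)%R](exp_ln t); last lra.
    by rewrite -exp_plus Re_minus /=; congr exp; ring.
  - rewrite -[X in _ = (_ / X)%R](exp_ln (1 - t)); last lra.
    rewrite /Rdiv -exp_Ropp -exp_plus; congr exp.
    by rewrite /M Re_minus re_RtoC S_INR re_RtoC; ring.
have e1 := exp_pos (Re (s - 1) * ln t); have e2 := exp_pos (Re (M - 1) * ln (1 - t)).
apply: Rle_trans (Rmult_le_compat_l _ _ _ _ h1) _; first by apply: Rmult_le_pos; lra.
by apply: Req_le; field; lra.
Qed.

(** By definition of Gamma, m^s B(s, m+1) tends to Gamma(s). Replacing m+1 by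
    w+m+1 changes the integral by O(B(Re s + 1, m)), which is o(m^(-Re s)), so
    m^s B(s, w+m+1) has the same limit. The recurrence writes B(s, w+m+1) as
    B(s, w) times a ratio of rising factorials, and m^s times that ratio tends to
    Gamma(s+w) / Gamma(w). *)
Lemma beta_Gamma s w : (0 < Re s)%R -> (0 < Re w)%R ->
  is_beta s w (Gamma s * Gamma w / Gamma (s + w)).
Proof.
move=> hs hw.
have [l hl] := ex_beta hs hw.
suff <- : l = Gamma s * Gamma w / Gamma (s + w) by [].
have hsw : (0 < Re (s + w))%R by rewrite Re_plus; lra.
have [lims gs] := Gamma_lim (nonpole_Re hs).
have [limw gw] := Gamma_lim (nonpole_Re hw).
have [limsw gsw] := Gamma_lim (nonpole_Re hsw).
set sg := RtoC (Re s).
have hsg : (0 < Re sg)%R by [].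
have [limsg _] := Gamma_lim (nonpole_Re hsg).
pose D m := l * (rising w m.+1 / rising (s + w) m.+1) - RtoC (INR m`!) / rising s m.+1.
have hD m : (Cmod (D m.+1) <= Cmod w * Re (RtoC (INR m`!) / rising (sg + 1) m.+1))%R.
  have hA := beta_plus_nat (m := m.+2) hs hw hl.
  have hB := beta_nat (m := m.+1) hs.
  have hsg1 : (0 < Re (sg + 1))%R by rewrite Re_plus /=; lra.
  have hC := beta_nat (m := m) hsg1.
  pose proof (is_CInt_gen_plus hA (is_CInt_gen_scal (c := - (1)) hB)) as hAB.
  have -> : D m.+1 = l * (rising w m.+2 / rising (s + w) m.+2)
      + - (1) * (RtoC (INR (m.+1)`!) / rising s m.+2) by rewrite /D; ring.
  pose proof (is_RInt_gen_scal _ (Cmod w) _ (is_CInt_gen_Re hC)) as hC'.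
  apply: (is_CInt_gen_norm _ _ hAB hC').
  - by apply: near01.
  - apply: near01 => u v hu huv hv t [ht0 ht1].
    have ht' : (0 < t < 1)%R.
      by split; [apply: Rlt_le_trans ht0 | apply: Rle_lt_trans hv].
    rewrite (_ : _ + _ = betaf s (w + RtoC (INR m.+2)) t - betaf s (RtoC (INR m.+2)) t).
      exact: betaf_shift_bound (Rlt_le _ _ hw) ht'.
    by ring.
have lim0 : clim (fun m => Rcpow (INR m) s * D m) 0.
  have lim1 : is_lim_seq (fun m => (Cmod w * Re s) / INR m * Cmod (gseq sg m))%R 0.
    rewrite -(Rmult_0_l (Cmod (Gamma sg))); apply: is_lim_seq_mult'.
      exact: is_lim_seq_inv_INR.
    exact: clim_mod.
  apply: (clim_squeeze (M := 1) _ lim1) => -[|m] hm; first lia.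
  have hm0 : (0 < INR m.+1)%R by apply: lt_0_INR; lia.
  rewrite (_ : forall z : C, z - 0 = z); last by move=> z; ring.
  rewrite Cmod_mult Cmod_Rcpow.
  have := Rmult_le_compat_l _ _ _ (Rlt_le _ _ (exp_pos (Re s * ln (INR m.+1)))) (hD m).
  move/Rle_trans; apply.
  set E := exp _.
  have hE : RtoC E = Rcpow (INR m.+1) sg by rewrite Rcpow_real.
  apply: Rle_trans (_ : Cmod w *
    Cmod (RtoC E * (RtoC (INR m`!) / rising (sg + 1) m.+1)) <= _)%R.
    rewrite (Rmult_comm E) Rmult_assoc; apply: Rmult_le_compat_l; first exact: Cmod_ge_0.
    rewrite Rmult_comm -re_scal_l.
    by apply: Rle_trans (Rle_abs _) _; apply: re_le_Cmod.
  have -> : RtoC E * (RtoC (INR m`!) / rising (sg + 1) m.+1) =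
      RtoC (Re s / INR m.+1) * gseq sg m.+1.
    rewrite /gseq (rising_shift sg) factS mult_INR RtoC_mult -hE RtoC_div; last lra.
    have h1 : rising (sg + 1) m.+1 <> 0.
      by apply: rising_neq0; apply: nonpole_Re; rewrite Re_plus /=; lra.
    have h2 : RtoC (INR m.+1) <> 0 by move/RtoC_inj; lra.
    have h3 := Cneq0_Re hsg.
    rewrite -/sg; field; by repeat split.
  rewrite Cmod_mult Cmod_R Rabs_pos_eq; first by apply: Req_le; field; lra.
  by apply/Rlt_le/Rdiv_lt_0_compat.
have lim2 : clim (fun m => l * (gseq (s + w) m * / gseq w m) + - gseq s m)
    (l * (Gamma (s + w) * / Gamma w) + - Gamma s).
  apply: clim_plus; last exact: clim_opp.
  apply: clim_mult; first exact: clim_const.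
  apply: clim_mult => //; apply: clim_inv => // m.
  exact: gseq_neq0 (nonpole_Re hw).
have e : RtoC 0 = l * (Gamma (s + w) * / Gamma w) + - Gamma s.
  apply: (clim_unique _ lim2).
  apply: (clim_ext_loc (M := 0%nat) _ lim0) => m hm.
  rewrite /D /gseq Rcpow_plus.
  have h1 := @rising_neq0 s m.+1 (nonpole_Re hs).
  have h2 := @rising_neq0 w m.+1 (nonpole_Re hw).
  have h3 := @rising_neq0 (s + w) m.+1 (nonpole_Re hsw).
  have h4 := @Rcpow_neq0 (INR m) w.
  have h5 := @INR_fact_neq0 m.
  by field; repeat split.
rewrite (_ : Gamma s = l * (Gamma (s + w) * / Gamma w)); first by field.
by apply: (Cplus_eq_reg_r (r := - Gamma s)); rewrite -e; ring.
Qed.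

(** * The integral of x^(mu-1) (x+a+sqrt(x^2+2ax))^(-lambda) *)

Section Oberhettinger.
Variable a : R.
Hypothesis ha : (0 < a)%R.

Definition bigX (x : R) : R := (x + a + sqrt (x ^ 2 + 2 * a * x))%R.

(** The new variable of integration. It decreases from 1 at x = 0 to 0 at
    infinity, and both x and X are monomials in a, T and 1 - T. *)
Let T (x : R) : R := (a / bigX x)%R.
Let r (x : R) : R := sqrt (x ^ 2 + 2 * a * x).

Lemma r_gt0 x : (0 < x)%R -> (0 < r x)%R.
Proof. by move=> hx; apply: sqrt_lt_R0; nra. Qed.

Lemma bigX_gt x : (0 < x)%R -> (x + a < bigX x)%R.
Proof. by move=> hx; rewrite /bigX -/(r x); have := r_gt0 hx; lra. Qed.

Lemma bigX_quadratic x : (0 < x)%R ->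
  (bigX x * bigX x = a * a + 2 * r x * bigX x)%R.
Proof.
move=> hx; have h : (r x * r x = x ^ 2 + 2 * a * x)%R by apply: sqrt_sqrt; nra.
rewrite /bigX -/(r x).
rewrite (_ : ((x + a + r x) * (x + a + r x) =
  (x + a) * (x + a) + 2 * (x + a) * r x + r x * r x)%R); last by ring.
rewrite (_ : (2 * r x * (x + a + r x) = 2 * (x + a) * r x + 2 * (r x * r x))%R);
  last by ring.
by rewrite h; ring.
Qed.

Lemma T_bounds x : (0 < x)%R -> (0 < T x < 1)%R.
Proof.
move=> hx; have h := bigX_gt hx; split; first by apply: Rdiv_lt_0_compat; lra.
by apply: (Rmult_lt_reg_r (bigX x)); rewrite /T ?(Rmult_1_l); first lra;
  rewrite /Rdiv Rmult_assoc Rinv_l; lra.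
Qed.

Lemma T_inverse x : (0 < x)%R -> x = (a / 2 * ((1 - T x) * (1 - T x)) / T x)%R.
Proof.
move=> hx; have h := bigX_gt hx; have h2 := bigX_quadratic hx.
have hr : (r x = bigX x - x - a)%R by rewrite /bigX -/(r x); ring.
rewrite hr in h2.
have -> : (a / 2 * ((1 - T x) * (1 - T x)) / T x =
  (bigX x * bigX x - 2 * a * bigX x + a * a) / (2 * bigX x))%R.
  by rewrite /T; field; lra.
rewrite (_ : (bigX x * bigX x - 2 * a * bigX x + a * a = x * (2 * bigX x))%R);
  last by lra.
by field; lra.
Qed.

Lemma is_derive_T x : (0 < x)%R -> is_derive T x (- (a / (r x * bigX x)))%R.
Proof.
move=> hx; have h := bigX_gt hx; have hr := r_gt0 hx.
have e : (x * (x * 1) + 2 * a * x = x ^ 2 + 2 * a * x)%R by ring.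
have hX : (x + a + r x <> 0)%R by rewrite /bigX -/(r x) in h; lra.
rewrite /T /bigX; auto_derive; rewrite !e -/(r x).
  by split; [nra | split].
by field; lra.
Qed.

Lemma T_jacobian x : (0 < x)%R ->
  (a / (r x * bigX x) * (1 + T x) = 2 / a * (T x * T x) / (1 - T x))%R.
Proof.
move=> hx; have h := bigX_gt hx; have hr := r_gt0 hx; have h2 := bigX_quadratic hx.
have e : (r x = (bigX x * bigX x - a * a) / (2 * bigX x))%R.
  by rewrite h2; field; lra.
have hd : (bigX x * bigX x - a * a <> 0)%R by nra.
rewrite e /T; field; repeat split; try lra.
Qed.

Lemma T_at_0 (P : R -> Prop) : at_left 1 P -> at_right 0 (fun x => P (T x)).
Proof.
case=> e he.
have hc : continuous T 0.
  apply: (continuous_mult (K := R_AbsRing) (fun=> a) (fun x => / bigX x)%R).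
    exact: continuous_const.
  apply: continuous_Rinv_comp.
    apply: (continuous_plus (fun x => x + a)%R (fun x => r x)).
      by apply: (ex_derive_continuous (V := R_NormedModule)); auto_derive.
    apply: (continuous_sqrt_comp (fun x => x ^ 2 + 2 * a * x)%R).
    by apply: (ex_derive_continuous (V := R_NormedModule)); auto_derive.
  rewrite /bigX (_ : (0 ^ 2 + 2 * a * 0 = 0)%R); last by ring.
  by rewrite sqrt_0; lra.
have hT0 : T 0 = 1%R.
  rewrite /T /bigX (_ : (0 ^ 2 + 2 * a * 0 = 0)%R); last by ring.
  by rewrite sqrt_0; field; lra.
have [d hd] := proj1 (filterlim_locally (U := R_UniformSpace) _ _) hc e.
exists d => x hx hx0; apply: he; last by case: (T_bounds hx0).
by have := hd x hx; rewrite hT0.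
Qed.

Lemma T_at_infty (P : R -> Prop) : at_right 0 P -> Rbar_locally p_infty (fun x => P (T x)).
Proof.
case=> e he; exists (Rmax 1 (a / e)) => x hx.
have h1 : (1 < x)%R by apply: Rle_lt_trans hx; apply: Rmax_l.
have h2 : (a / e < x)%R by apply: Rle_lt_trans hx; apply: Rmax_r.
have hx0 : (0 < x)%R by lra.
have [hT0 hT1] := T_bounds hx0.
have he0 := cond_pos e.
apply: he => //.
change (Rabs (T x - 0) < e)%R; rewrite Rminus_0_r Rabs_pos_eq; last lra.
have hX := bigX_gt hx0.
apply: (Rmult_lt_reg_r (bigX x)); first lra.
rewrite /T /Rdiv Rmult_assoc Rinv_l ?Rmult_1_r; last lra.
apply: Rlt_trans (_ : e * x < _)%R; last by apply: Rmult_lt_compat_l; lra.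
rewrite (_ : a = e * (a / e))%R; last by field; lra.
by apply: Rmult_lt_compat_l.
Qed.

Lemma RInt_subst_T (phi : R -> R) (u v l : R) : (0 < u)%R -> (u <= v)%R ->
  (forall t, 0 < t < 1 -> continuous phi t)%R ->
  is_RInt phi (T v) (T u) l ->
  is_RInt (fun x => a / (r x * bigX x) * phi (T x))%R u v l.
Proof.
move=> hu huv hc h.
have hcomp := @is_RInt_comp R_CompleteNormedModule phi T
  (fun x => - (a / (r x * bigX x)))%R u v.
have {hcomp} : is_RInt (fun y => scal (- (a / (r y * bigX y)))%R (phi (T y))) u v
    (RInt phi (T u) (T v)).
  apply: hcomp => x; rewrite Rmin_left // Rmax_right // => hx;
    have hx0 : (0 < x)%R by lra.
    by apply: hc; apply: T_bounds.
  split; first exact: is_derive_T.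
  have hr := r_gt0 hx0; have hX := bigX_gt hx0.
  apply: (ex_derive_continuous (V := R_NormedModule)).
  have e : (x * (x * 1) + 2 * a * x = x ^ 2 + 2 * a * x)%R by ring.
  rewrite /r /bigX; auto_derive; rewrite !e -/(r x) -/(bigX x).
  split; first by nra.
  have hp : (0 < r x * bigX x)%R by apply: Rmult_lt_0_compat; lra.
  by split; [nra | split => //; apply: Rgt_not_eq hp].
rewrite (is_RInt_unique _ _ _ _ (is_RInt_swap _ _ _ _ h)) => hq.
have := is_RInt_opp _ _ _ _ hq.
rewrite (_ : opp (opp l) = l); last by rewrite /opp /=; ring.
apply: is_RInt_ext => x _; rewrite /opp /scal /= /mult /=; ring.
Qed.

Lemma CInt_gen_subst_T (phi : R -> C) (l : C) :
  (forall t, 0 < t < 1 -> ccont phi t)%R ->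
  is_CInt_gen phi (at_right 0) (at_left 1) l ->
  is_CInt_gen (fun x => RtoC (a / (r x * bigX x)) * phi (T x))
    (at_right 0) (Rbar_locally p_infty) l.
Proof.
move=> hc /is_CInt_gen_eps h; apply/is_CInt_gen_eps => eps he.
case: (h eps he) => Q S hQ hS hQS.
apply: (Filter_prod _ _ _ (fun u => S (T u) /\ 0 < u < 1)%R (fun v => Q (T v) /\ 1 < v)%R).
- exact: (filter_and _ _ (T_at_0 hS) near_right0_lt1).
- apply: (filter_and _ _ (T_at_infty hQ)); by exists 1%R.
- move=> u v [hu hu0] [hv hv1] /=.
  have [z [hz hz']] := hQS _ _ hv hu.
  exists z; split => //; rewrite /= in hz.
  have hu00 : (0 < u)%R by lra.
  have huv : (u <= v)%R by lra.
  apply: is_CInt_of_ReIm.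
  + apply: (is_RInt_ext (fun x => a / (r x * bigX x) * Re (phi (T x)))%R).
      by move=> x _; rewrite re_scal_l.
    by apply: (RInt_subst_T (phi := fun t => Re (phi t))) => //;
      [move=> t /hc [] | apply: is_CInt_Re].
  + apply: (is_RInt_ext (fun x => a / (r x * bigX x) * Im (phi (T x)))%R).
      by move=> x _; rewrite im_scal_l.
    by apply: (RInt_subst_T (phi := fun t => Im (phi t))) => //;
      [move=> t /hc [] | apply: is_CInt_Im].
Qed.

Definition kernel (lam mu : C) (x : R) : C := Rcpow x (mu - 1) * Rcpow (bigX x) (- lam).

Lemma kernel_subst lam mu x : (0 < x)%R ->
  kernel lam mu x = RtoC (a / (r x * bigX x)) *
    (Rcpow (a / 2) mu * Rcpow a (- lam) *
      (betaf (lam - mu) (2 * mu) (T x) + betaf (lam - mu + 1) (2 * mu) (T x))).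
Proof.
move=> hx; have hT := T_bounds hx; have hj := T_jacobian hx; have hX := bigX_gt hx.
have hXT : bigX x = (a / T x)%R by rewrite /T; field; lra.
rewrite betaf_succl; last lra.
rewrite (_ : betaf _ _ (T x) + RtoC (T x) * _ =
  (1 + RtoC (T x)) * betaf (lam - mu) (2 * mu) (T x)); last by ring.
rewrite (_ : RtoC _ * (_ * _) = Rcpow (a / 2) mu * Rcpow a (- lam)
  * (RtoC (a / (r x * bigX x)) * (1 + RtoC (T x))) * betaf (lam - mu) (2 * mu) (T x));
  last by ring.
rewrite -RtoC_plus -RtoC_mult hj /kernel.
rewrite {1}(T_inverse hx) {1}hXT.
move: (T x) hT => t ht.
have ht1 : (0 < 1 - t)%R by lra.
have [q hq] : exists q, q = (a / 2)%R by eexists.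
have hq0 : (0 < q)%R by lra.
rewrite (_ : (2 / a * (t * t) / (1 - t) = t * t / (q * (1 - t)))%R); last first.
  by rewrite hq; field; lra.
rewrite -hq.
have hm1 y z : (0 < y)%R -> Rcpow y (z - 1) = Rcpow y z / RtoC y.
  by move=> hy; rewrite (_ : z - 1 = z + - (1)) ?Rcpow_plus ?Rcpow_opp ?Rcpow_1 //; ring.
have h1t : (0 < (1 - t) * (1 - t))%R by apply: Rmult_lt_0_compat.
rewrite Rcpow_div //; [|by apply: Rmult_lt_0_compat | lra].
rewrite Rcpow_mult // (@Rcpow_mult (1 - t) (1 - t)) // (@Rcpow_div a t) //; last lra.
rewrite /betaf !hm1 //; try lra.
rewrite (_ : 2 * mu = mu + mu); last by ring.
rewrite (_ : lam - mu = lam + - mu); last by ring.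
rewrite !Rcpow_plus !Rcpow_opp RtoC_div; last by apply/Rgt_not_eq/Rmult_lt_0_compat.
rewrite !RtoC_mult.
have h1 : RtoC q <> 0 by move/RtoC_inj; lra.
have h2 : RtoC t <> 0 by move/RtoC_inj; lra.
have h3 : RtoC (1 - t) <> 0 by move/RtoC_inj; lra.
have h5 := @Rcpow_neq0 a lam; have h6 := @Rcpow_neq0 t lam; have h7 := @Rcpow_neq0 t mu.
have h8 := @Rcpow_neq0 (1 - t)%R mu.
by field; repeat split.
Qed.

(** Oberhettinger's integral. After the substitution the factor 1 + t of the
    Jacobian splits the integral into B(lam-mu, 2mu) + B(lam-mu+1, 2mu), and the
    recurrence of Gamma merges the two into one term with the factor 2 lam. *)
Lemma kernel_integral lam mu : (0 < Re mu)%R -> (Re mu < Re lam)%R ->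
  is_CInt_gen (kernel lam mu) (at_right 0) (Rbar_locally p_infty)
    (2 * lam * Rcpow a (- lam) * Rcpow (a / 2) mu * Gamma (2 * mu) * Gamma (lam - mu)
      / Gamma (1 + lam + mu)).
Proof.
move=> hmu hlam.
have hs : (0 < Re (lam - mu))%R by rewrite Re_minus; lra.
have hs1 : (0 < Re (lam - mu + 1))%R by rewrite Re_plus re_RtoC; lra.
have hw : (0 < Re (2 * mu))%R by rewrite re_scal_l; lra.
have hq : (0 < Re (lam + mu))%R by rewrite Re_plus; lra.
pose proof (is_CInt_gen_scal (c := Rcpow (a / 2) mu * Rcpow a (- lam))
  (is_CInt_gen_plus (beta_Gamma hs hw) (beta_Gamma hs1 hw))) as h.
apply CInt_gen_subst_T in h; last first.
  move=> t ht; apply: ccont_mult; first exact: ccont_const.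
  by apply: ccont_plus; apply: ccont_betaf.
move: h.
rewrite (Gamma_succ (nonpole_Re hs)).
rewrite (_ : lam - mu + 2 * mu = lam + mu); last by ring.
rewrite (_ : lam - mu + 1 + 2 * mu = lam + mu + 1); last by ring.
rewrite (_ : 1 + lam + mu = lam + mu + 1); last by ring.
rewrite (Gamma_succ (nonpole_Re hq)).
rewrite (_ : _ * (_ + _) = 2 * lam * Rcpow a (- lam) * Rcpow (a / 2) mu
  * Gamma (2 * mu) * Gamma (lam - mu) / ((lam + mu) * Gamma (lam + mu))); last first.
  have h1 := Gamma_neq0 (nonpole_Re hq); have h2 := Cneq0_Re hq.
  by field.
apply: is_RInt_gen_ext.
apply: (Filter_prod _ _ _ (fun u => 0 < u < 1)%R (fun v => 1 < v)%R).
- exact: near_right0_lt1.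
- by exists 1%R.
- move=> u v hu hv x /=; rewrite Rmin_left ?Rmax_right; try lra.
  by move=> hx; rewrite kernel_subst //; lra.
Qed.

End Oberhettinger.

Section KernelBounds.
Variable a : R.
Hypothesis ha : (0 < a)%R.

Lemma kernel_shift lam mu s x : (0 < x)%R ->
  kernel a lam mu x * Rcpow (x / bigX a x) s = kernel a (lam + s) (mu + s) x.
Proof.
move=> hx; have hX := bigX_gt ha hx.
rewrite Rcpow_div //; last lra.
rewrite /kernel (_ : mu + s - 1 = mu - 1 + s); last by ring.
rewrite (_ : - (lam + s) = - lam + - s); last by ring.
by rewrite !Rcpow_plus (Rcpow_opp _ s) /Cdiv; ring.
Qed.

(** The modulus of a kernel is the kernel of the real parts, so kernel_integral
    also gives absolute integrability. *)
Lemma Cmod_kernel lam mu x :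
  Cmod (kernel a lam mu x) = Re (kernel a (RtoC (Re lam)) (RtoC (Re mu)) x).
Proof.
rewrite /kernel Cmod_mult !Cmod_Rcpow -RtoC_minus -RtoC_opp !Rcpow_real -RtoC_mult re_RtoC.
by rewrite Re_minus Re_opp re_RtoC.
Qed.

Lemma ccont_kernel lam mu x : (0 < x)%R -> ccont (kernel a lam mu) x.
Proof.
move=> hx; apply: ccont_mult; first exact: ccont_Rcpow.
have hX := bigX_gt ha hx.
have hd : ex_derive (fun x => ln (bigX a x)) x.
  rewrite /bigX; auto_derive.
  have e : (x * (x * 1) + 2 * a * x = x ^ 2 + 2 * a * x)%R by ring.
  rewrite !e -/(bigX a x); split; first by nra.
  by split => //; lra.
exact: cderiv_ccont (cderiv_exp_comp (- lam) (Derive_correct _ _ hd)).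
Qed.

Lemma continuous_Cmod_kernel lam mu x : (0 < x)%R ->
  continuous (fun x => Cmod (kernel a lam mu x)) x.
Proof.
move=> hx.
apply: (continuous_ext (fun x => Re (kernel a (RtoC (Re lam)) (RtoC (Re mu)) x))).
  by move=> t; rewrite Cmod_kernel.
by case: (ccont_kernel (RtoC (Re lam)) (RtoC (Re mu)) hx).
Qed.

Lemma Cmod_kernel_integral lam mu : (0 < Re mu)%R -> (Re mu < Re lam)%R ->
  exists G, is_RInt_gen (fun x => Cmod (kernel a lam mu x))
    (at_right 0) (Rbar_locally p_infty) G.
Proof.
move=> hmu hlam.
pose proof (is_CInt_gen_Re (kernel_integral (lam := RtoC (Re lam)) (mu := RtoC (Re mu)) ha hmu hlam)) as h.
eexists; apply: is_RInt_gen_ext h.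
by apply: filter_forall => ab x _; rewrite Cmod_kernel.
Qed.

Lemma ratio_bounds x : (0 < x)%R -> (0 < x / bigX a x <= 1)%R.
Proof.
move=> hx; have hX := bigX_gt ha hx; split; first by apply: Rdiv_lt_0_compat; lra.
apply: (Rmult_le_reg_r (bigX a x)); first lra.
by rewrite /Rdiv Rmult_assoc Rinv_l; lra.
Qed.

End KernelBounds.

(** * Multiple series over cubes *)

HB.instance Definition _ := Monoid.isComLaw.Build R 0%R Rplus
  (fun x y z => esym (Rplus_assoc x y z)) Rplus_comm Rplus_0_l.
HB.instance Definition _ := Monoid.isComLaw.Build R 1%R Rmult
  (fun x y z => esym (Rmult_assoc x y z)) Rmult_comm Rmult_1_l.
HB.instance Definition _ := Monoid.isMulLaw.Build R 0%R Rmult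
  Rmult_0_l Rmult_0_r.
HB.instance Definition _ := Monoid.isAddLaw.Build R Rmult Rplus
  (fun x y z => Rmult_plus_distr_r x y z) (fun x y z => Rmult_plus_distr_l x y z).

Local Notation "\Csum_ ( i <- r | P ) F" := (\big[Cplus/RtoC 0]_(i <- r | P%B) F)
  (at level 41, F at level 41, i, r at level 50).
Local Notation "\Csum_ ( i <- r ) F" := (\big[Cplus/RtoC 0]_(i <- r) F)
  (at level 41, F at level 41, i, r at level 50).
Local Notation "\Rsum_ ( i <- r | P ) F" := (\big[Rplus/0%R]_(i <- r | P%B) F)
  (at level 41, F at level 41, i, r at level 50).
Local Notation "\Rsum_ ( i <- r ) F" := (\big[Rplus/0%R]_(i <- r) F)
  (at level 41, F at level 41, i, r at level 50).

Lemma Cmod_sum_le (I : Type) (r : seq I) (P : pred I) (f : I -> C) (w : I -> R) :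
  (forall i, Cmod (f i) <= w i)%R ->
  (Cmod (\Csum_(i <- r | P i) f i) <= \Rsum_(i <- r | P i) w i)%R.
Proof.
move=> h; elim/big_rec2: _ => [|i x y _ IH]; first by rewrite Cmod_0; apply: Rle_refl.
by apply: Rle_trans (Cmod_triangle _ _) _; apply: Rplus_le_compat.
Qed.

Lemma Cmod_prod (I : Type) (r : seq I) (f : I -> C) :
  Cmod (\big[Cmult/RtoC 1]_(i <- r) f i) = \big[Rmult/1%R]_(i <- r) Cmod (f i).
Proof. by apply: big_morph; [apply: Cmod_mult | apply: Cmod_1]. Qed.

Lemma Rprod_ge0 (I : Type) (r : seq I) (f : I -> R) :
  (forall i, 0 <= f i)%R -> (0 <= \big[Rmult/1%R]_(i <- r) f i)%R.
Proof.
by move=> h; elim/big_rec: _ => [|i x _ IH]; [lra | apply: Rmult_le_pos].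
Qed.

Lemma Rprod_le (I : Type) (r : seq I) (f g : I -> R) :
  (forall i, 0 <= f i <= g i)%R ->
  (\big[Rmult/1%R]_(i <- r) f i <= \big[Rmult/1%R]_(i <- r) g i)%R.
Proof.
move=> h; suff : (0 <= \big[Rmult/1%R]_(i <- r) f i <= \big[Rmult/1%R]_(i <- r) g i)%R.
  by case.
elim/big_rec2: _ => [|i x y _ [IH1 IH2]]; first lra.
have [h1 h2] := h i; split; first exact: Rmult_le_pos.
exact: Rmult_le_compat.
Qed.

Lemma Rsum_ge0 (I : Type) (r : seq I) (P : pred I) (f : I -> R) :
  (forall i, 0 <= f i)%R -> (0 <= \Rsum_(i <- r | P i) f i)%R.
Proof. by move=> h; elim/big_rec: _ => [|i x _ IH]; have := h; [lra | move=> /(_ i); lra]. Qed.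

Lemma Csum_RtoC (I : Type) (r : seq I) (f : I -> R) :
  \big[Cplus/RtoC 0]_(i <- r) RtoC (f i) = RtoC (\big[Rplus/0%R]_(i <- r) f i).
Proof. by rewrite (big_morph RtoC RtoC_plus (erefl (RtoC 0))). Qed.

Lemma Csum_const1 n : \big[Cplus/RtoC 0]_(j < n) RtoC 1 = RtoC (INR n).
Proof.
elim: n => [|n IH]; first by rewrite big_ord0.
by rewrite big_ord_recr IH S_INR RtoC_plus.
Qed.

Lemma Rcpow_sum x (I : Type) (r : seq I) (s : I -> C) :
  \big[Cmult/RtoC 1]_(i <- r) Rcpow x (s i) = Rcpow x (\big[Cplus/RtoC 0]_(i <- r) s i).
Proof. by rewrite (big_morph (Rcpow x) (Rcpow_plus x) (Rcpow_0 x)). Qed.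

Lemma Cprod_const n (z : C) : \big[Cmult/RtoC 1]_(j < n) z = z ^ n.
Proof.
elim: n => [|n IH]; first by rewrite big_ord0.
by rewrite big_ord_recr IH Cpow_S Cmult_comm.
Qed.

Lemma sum_split_sub (V : Type) (idx : V) (op : Monoid.com_law idx) (T : eqType)
    (r s : seq T) (f : T -> V) : uniq r -> uniq s -> {subset r <= s} ->
  \big[op/idx]_(k <- s) f k =
    op (\big[op/idx]_(k <- r) f k) (\big[op/idx]_(k <- s | k \notin r) f k).
Proof.
move=> ur us rs; rewrite (bigID (mem r)) /=; congr (op _ _).
rewrite -big_filter; apply: perm_big; apply: uniq_perm => //.
  exact: filter_uniq.
move=> k; rewrite mem_filter /=.
by case hk: (k \in r) => //=; apply: rs.
Qed.

Lemma Rsum_le_sub (T : eqType) (r s : seq T) (w : T -> R) :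
  (forall k, 0 <= w k)%R -> uniq r -> uniq s -> {subset r <= s} ->
  (\Rsum_(k <- r) w k <= \Rsum_(k <- s) w k)%R.
Proof.
move=> hw ur us rs; rewrite (@sum_split_sub _ _ Rplus _ r s) //.
by have /= := @Rsum_ge0 _ s (fun k => k \notin r) w hw; lra.
Qed.

(** The difference of the two sums runs over s minus r, which is contained in
    t minus r. *)
Lemma Csum_sub_bound (T : eqType) (r s t : seq T) (f : T -> C) (w : T -> R) :
  (forall k, Cmod (f k) <= w k)%R -> uniq r -> uniq s -> uniq t ->
  {subset r <= s} -> {subset s <= t} ->
  (Cmod (\Csum_(k <- s) f k - \Csum_(k <- r) f k)
    <= \Rsum_(k <- t) w k - \Rsum_(k <- r) w k)%R.
Proof.
move=> h ur us ut rs st.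
have hw k : (0 <= w k)%R by apply: Rle_trans (h k); apply: Cmod_ge_0.
rewrite (@sum_split_sub _ _ Cplus _ r s) //.
have -> : \Csum_(k <- r) f k + \Csum_(k <- s | k \notin r) f k - \Csum_(k <- r) f k =
  \Csum_(k <- s | k \notin r) f k by ring.
apply: Rle_trans (Cmod_sum_le _ _ h) _.
rewrite (@sum_split_sub _ _ Rplus _ r t) //; last by move=> k /rs /st.
rewrite (_ : forall x y : R, x + y - x = y)%R; last by move=> x y; ring.
rewrite -!(big_filter _ (fun k => k \notin r)).
apply: Rsum_le_sub => //; try exact: filter_uniq.
by move=> k; rewrite !mem_filter => /andP [-> /st].
Qed.

Section Box.
Variable n : nat.
Local Notation idx := {ffun 'I_n -> nat}.

(** Multi-indices with all entries below M. The sum over a cube of a product of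
    functions of one index is a product of ordinary partial sums, and cubes
    exhaust all finite sets of multi-indices. *)
Definition box (M : nat) : seq idx :=
  [seq [ffun j => nat_of_ord (f j)] : idx | f : {ffun 'I_n -> 'I_M} <- enum {: {ffun 'I_n -> 'I_M}}].

Lemma box_uniq M : uniq (box M).
Proof.
rewrite map_inj_uniq ?enum_uniq // => f g /ffunP h.
by apply/ffunP => j; apply: val_inj; have := h j; rewrite !ffunE.
Qed.

Lemma mem_box M (k : idx) : (k \in box M) = [forall j, (k j < M)%nat].
Proof.
apply/mapP/forallP => [[f _ ->] j|h]; first by rewrite ffunE.
exists [ffun j => Ordinal (h j)]; first by rewrite mem_enum.
by apply/ffunP => j; rewrite !ffunE.
Qed.

Lemma box_mono M M' : (M <= M')%nat -> {subset box M <= box M'}.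
Proof.
move=> hM k; rewrite !mem_box => /forallP h; apply/forallP => j.
exact: leq_trans (h j) hM.
Qed.

Lemma box_exhaust (s : seq idx) : exists M, {subset s <= box M}.
Proof.
elim: s => [|k s [M hM]]; first by exists 0%nat.
exists (maxn M (\max_j (k j)).+1) => k'; rewrite inE => /orP [/eqP ->|].
- rewrite mem_box; apply/forallP => j; rewrite leq_max; apply/orP; right.
  by rewrite ltnS; apply: leq_bigmax.
- by move/hM; apply: box_mono; apply: leq_maxl.
Qed.

Lemma box_distr (V : Type) (zero one : V) (times : Monoid.mul_law zero)
    (plus : Monoid.add_law zero times) (F : 'I_n -> nat -> V) M :
  \big[times/one]_(j < n) \big[plus/zero]_(k < M) F j k =
  \big[plus/zero]_(k <- box M) \big[times/one]_(j < n) F j (k j).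
Proof.
rewrite bigA_distr_bigA /box big_map big_enum /=.
by apply: eq_bigr => f _; apply: eq_bigr => j _; rewrite ffunE.
Qed.

Variable D : 'I_n -> nat -> R.
Hypothesis D_ge0 : forall j k, (0 <= D j k)%R.
Hypothesis D_sum : forall j, ex_series (D j).

Definition box_weight (k : idx) : R := \big[Rmult/1%R]_(j < n) D j (k j).
Definition box_mass (M : nat) : R := \Rsum_(k <- box M) box_weight k.

Lemma box_weight_ge0 k : (0 <= box_weight k)%R.
Proof. by apply: Rprod_ge0 => j; apply: D_ge0. Qed.

Lemma sum_n_big (u : nat -> R) M : sum_n u M = \big[Rplus/0%R]_(k < M.+1) u k.
Proof.
elim: M => [|M IH]; first by rewrite sum_O big_ord_recl big_ord0 Rplus_0_r.
by rewrite sum_Sn IH [RHS]big_ord_recr.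
Qed.

Lemma is_lim_seq_prod (I : Type) (r : seq I) (u : I -> nat -> R) (l : I -> R) :
  (forall i, is_lim_seq (u i) (l i)) ->
  is_lim_seq (fun m => \big[Rmult/1%R]_(i <- r) u i m) (\big[Rmult/1%R]_(i <- r) l i).
Proof.
move=> h; elim: r => [|i r IH].
  rewrite big_nil; apply: (is_lim_seq_ext (fun=> 1%R)); last exact: is_lim_seq_const.
  by move=> m; rewrite big_nil.
rewrite big_cons; apply: (is_lim_seq_ext (fun m => u i m * \big[Rmult/1%R]_(i <- r) u i m)%R).
  by move=> m; rewrite big_cons.
exact: is_lim_seq_mult'.
Qed.

Lemma box_mass_lim :
  is_lim_seq box_mass (\big[Rmult/1%R]_(j < n) Series (D j)).
Proof.
apply: (is_lim_seq_ext (fun M => \big[Rmult/1%R]_(j < n) \big[Rplus/0%R]_(k < M) D j k)).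
  by move=> M; rewrite box_distr.
apply: is_lim_seq_prod => j.
apply/is_lim_seq_incr_1.
apply: (is_lim_seq_ext (sum_n (D j))); first by move=> M; rewrite sum_n_big.
exact: Series_correct.
Qed.

Lemma box_mass_mono M M' : (M <= M')%nat -> (box_mass M <= box_mass M')%R.
Proof.
move=> h; apply: Rsum_le_sub; first exact: box_weight_ge0.
- exact: box_uniq.
- exact: box_uniq.
- exact: box_mono.
Qed.

Definition box_tail (M : nat) : R := (\big[Rmult/1%R]_(j < n) Series (D j) - box_mass M)%R.

Lemma box_mass_le M : (box_mass M <= \big[Rmult/1%R]_(j < n) Series (D j))%R.
Proof.
apply: (is_lim_seq_incr_compare box_mass) => [|m]; first exact: box_mass_lim.
exact: box_mass_mono.
Qed.

Lemma box_tail_ge0 M : (0 <= box_tail M)%R.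
Proof. by have := box_mass_le M; rewrite /box_tail; lra. Qed.

Lemma box_tail_lim : is_lim_seq box_tail 0.
Proof.
rewrite -(Rminus_diag_eq (\big[Rmult/1%R]_(j < n) Series (D j)) _ erefl).
by apply: is_lim_seq_minus'; [apply: is_lim_seq_const | apply: box_mass_lim].
Qed.

Section Dominated.
Variables (f : idx -> C) (c : R).
Hypothesis hf : forall k, (Cmod (f k) <= c * box_weight k)%R.
Hypothesis c_ge0 : (0 <= c)%R.

Lemma dominated_sub_bound (s : seq idx) M : uniq s -> {subset box M <= s} ->
  (Cmod (\Csum_(k <- s) f k - \Csum_(k <- box M) f k) <= c * box_tail M)%R.
Proof.
move=> us hs; have [M' hM'] := box_exhaust s.
apply: Rle_trans (Csum_sub_bound hf (box_uniq M) us (box_uniq M') hs hM') _.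
have e r : \Rsum_(k <- r) (c * box_weight k)%R = (c * \Rsum_(k <- r) box_weight k)%R.
  by rewrite big_distrr.
rewrite !e -/(box_mass M) -/(box_mass M').
have := box_mass_le M'; rewrite /box_tail => h.
by rewrite -Rmult_minus_distr_l; apply: Rmult_le_compat_l => //; lra.
Qed.

Lemma dominated_box_bound M M' : (M <= M')%nat ->
  (Cmod (\Csum_(k <- box M') f k - \Csum_(k <- box M) f k) <= c * box_tail M)%R.
Proof. by move=> h; apply: dominated_sub_bound (box_uniq M') (box_mono h). Qed.

(** Adding indices outside a cube changes the sum by at most the tail of the
    dominating product series, however the indices are chosen: hence convergence
    along cubes upgrades to unconditional convergence. *)
Lemma dominated_summable : exists l,
  is_sum_over f l /\ clim (fun M => \Csum_(k <- box M) f k) l.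
Proof.
have tail0 : is_lim_seq (fun M => c * box_tail M)%R 0.
  rewrite -(Rmult_0_r c); apply: is_lim_seq_mult'; first exact: is_lim_seq_const.
  exact: box_tail_lim.
have [|l hl] := @clim_cauchy (fun M => \Csum_(k <- box M) f k)
  (fun M => c * box_tail M)%R 0 _ tail0.
  by move=> M M' _ hM; apply: dominated_box_bound; apply/leP.
exists l; split => // eps.
have he2 : (0 < eps / 2)%R by have := cond_pos eps; lra.
have [N1 h1] := proj2 (is_lim_seq_spec _ _) tail0 (mkposreal _ he2).
have [N2 h2] := proj2 (is_lim_seq_spec _ _) hl (mkposreal _ he2).
pose M := maxn N1 N2.
exists (box M) => s us hs.
have {}h1 := h1 M ltac:(by apply/leP/leq_maxl).
have {}h2 := h2 M ltac:(by apply/leP/leq_maxr).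
move: h1 h2; rewrite /= !Rminus_0_r => /Rabs_def2 [h1 _] /Rabs_def2 [h2 _].
rewrite (_ : \Csum_(k <- s) f k - l = (\Csum_(k <- s) f k - \Csum_(k <- box M) f k)
  + (\Csum_(k <- box M) f k - l)); last by ring.
apply: Rle_lt_trans (Cmod_triangle _ _) _.
rewrite [X in (_ < X)%R](_ : pos eps = (eps / 2 + eps / 2)%R); last by field.
apply: Rplus_le_lt_compat; last exact: h2.
exact: Rle_trans (dominated_sub_bound us hs) (Rlt_le _ _ h1).
Qed.

End Dominated.
End Box.

(** * Termwise integration under a dominated weight *)

Lemma is_CInt_gen_sum (Fa Fb : (R -> Prop) -> Prop) {FFa : ProperFilter Fa}
    {FFb : ProperFilter Fb} (I : Type) (r : seq I) (f : I -> R -> C) (l : I -> C) :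
  (forall i, is_CInt_gen (f i) Fa Fb (l i)) ->
  is_CInt_gen (fun x => \big[Cplus/RtoC 0]_(i <- r) f i x) Fa Fb
    (\big[Cplus/RtoC 0]_(i <- r) l i).
Proof.
move=> h; elim: r => [|i r IH].
  rewrite big_nil; apply/is_CInt_gen_eps => eps he.
  apply: filter_forall => ab; exists (RtoC 0); split.
    apply: (is_RInt_ext (V := C_R_NormedModule) (fun=> RtoC 0)).
      by move=> x _; rewrite big_nil.
    have := is_RInt_const (V := C_R_NormedModule) ab.1 ab.2 (RtoC 0).
    by rewrite [scal _ _](_ : _ = RtoC 0) // scal_R_Cmult Cmult_0_r.
  by rewrite (_ : RtoC 0 - RtoC 0 = 0) ?Cmod_0 //; ring.
rewrite big_cons.
rewrite (_ : (fun x => _) = fun x => f i x + \big[Cplus/RtoC 0]_(i <- r) f i x).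
  exact: is_CInt_gen_plus.
by apply: functional_extensionality => x; rewrite big_cons.
Qed.

Section Exchange.
Variables (f : R -> C) (S : nat -> R -> C) (g : R -> R) (G : R) (E : nat -> R).
Hypothesis E_ge0 : forall M, (0 <= E M)%R.
Hypothesis E_lim : is_lim_seq E 0.
Hypothesis g_cont : forall x, (0 < x)%R -> continuous g x.
Hypothesis S_cont : forall M x, (0 < x)%R -> ccont (S M) x.
Hypothesis S_approx : forall M x, (0 < x)%R -> (Cmod (f x - S M x) <= E M * g x)%R.

(** On a compact interval g is bounded, so f is a uniform limit of integrable
    functions; cutting off outside the interval makes the convergence uniform on
    the whole line. *)
Lemma exchange_ex_CInt u v : (0 < u)%R -> (u <= v)%R -> exists z, is_CInt f u v z.
Proof.
move=> hu huv.
pose cut (h : R -> C) x : C :=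
  if Rle_dec u x then (if Rle_dec x v then h x else RtoC 0) else RtoC 0.
have cutE h x : (u < x < v)%R -> cut h x = h x.
  move=> hx; rewrite /cut; case: (Rle_dec u x) => h1; last by exfalso; lra.
  by case: (Rle_dec x v) => h2 //; exfalso; lra.
have hS M : exists z, is_CInt (S M) u v z.
  by apply: ex_CInt_ccont => // t ht; apply: S_cont; lra.
pose I M : C := (RInt (V := C_R_CompleteNormedModule) (S M) u v).
have hI M : is_CInt (cut (S M)) u v (I M).
  have [z hz] := hS M.
  apply: (is_CInt_ext huv (f := S M)); first by move=> x hx; rewrite cutE.
  by rewrite /I (is_RInt_unique (V := C_R_CompleteNormedModule) _ _ _ _ hz).
have [xm [hxm _]] := continuity_ab_maj g u v huv
  (fun x hx => proj2 (continuity_pt_filterlim g x) (g_cont (Rlt_le_trans _ _ _ hu (proj1 hx)))).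
have lim0 : is_lim_seq (fun M => E M * (Rabs (g xm)))%R 0.
  rewrite -(Rmult_0_l (Rabs (g xm))); apply: is_lim_seq_mult' => //.
  exact: is_lim_seq_const.
have hcut : filterlim (fun M => cut (S M)) eventually
    (locally (T := fct_UniformSpace R C_R_CompleteNormedModule) (cut f)).
  apply/(filterlim_locally (U := fct_UniformSpace R C_R_CompleteNormedModule)) => eps.
  have [N hN] := proj2 (is_lim_seq_spec _ _) lim0 eps.
  exists N => M hM x.
  apply: (@ball_of_Cmod (cut f x)).
  have := hN M hM; rewrite Rminus_0_r => /Rabs_def2 [h1 _].
  have h0 : (0 <= E M * Rabs (g xm))%R by apply: Rmult_le_pos => //; apply: Rabs_pos.
  rewrite /cut; case: (Rle_dec u x) => hx1; [case: (Rle_dec x v) => hx2 |];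
    try by rewrite (_ : RtoC 0 - RtoC 0 = 0) ?Cmod_0; [apply: cond_pos | ring].
  rewrite Cmod_minusC; apply: Rle_lt_trans h1.
  apply: Rle_trans (S_approx M _) _; first lra.
  apply: Rmult_le_compat_l => //.
  by apply: Rle_trans (hxm x (conj hx1 hx2)) _; apply: Rle_abs.
have [z [_ hz]] := @filterlim_RInt nat C_R_CompleteNormedModule (fun M => cut (S M)) u v
  eventually _ (cut f) I hI hcut.
by exists z; apply: (is_CInt_ext huv _ hz) => x hx; apply: cutE.
Qed.

Variables (I : nat -> C) (l : C).
Hypothesis g_int : is_RInt_gen g (at_right 0) (Rbar_locally p_infty) G.
Hypothesis S_int : forall M, is_CInt_gen (S M) (at_right 0) (Rbar_locally p_infty) (I M).
Hypothesis I_lim : clim I l.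

Lemma near_half_line :
  filter_prod (at_right 0) (Rbar_locally p_infty) (fun ab => 0 < ab.1 /\ ab.1 <= ab.2)%R.
Proof.
apply: (Filter_prod _ _ _ (fun u => 0 < u < 1)%R (fun v => 1 < v)%R).
- exact: near_right0_lt1.
- by exists 1%R.
- by move=> u v /= hu hv; lra.
Qed.

(** The error of the approximation is integrated against g, uniformly in the
    bounds of integration; this is what dominated convergence amounts to when the
    error has the form E M * g x. *)
Lemma exchange_integral : is_CInt_gen f (at_right 0) (Rbar_locally p_infty) l.
Proof.
apply/is_CInt_gen_eps => eps he.
have he3 : (0 < eps / 3)%R by lra.
have lim0 : is_lim_seq (fun M => E M * (Rabs G + 1))%R 0.
  rewrite -(Rmult_0_l (Rabs G + 1)); apply: is_lim_seq_mult' => //.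
  exact: is_lim_seq_const.
have [N1 h1] := proj2 (is_lim_seq_spec _ _) lim0 (mkposreal _ he3).
have [N2 h2] := proj2 (is_lim_seq_spec _ _) I_lim (mkposreal _ he3).
pose M := maxn N1 N2.
have {}h1 := h1 M ltac:(by apply/leP/leq_maxl).
have {}h2 := h2 M ltac:(by apply/leP/leq_maxr).
move: h1 h2; rewrite /= !Rminus_0_r => /Rabs_def2 [h1 _] /Rabs_def2 [h2 _].
pose proof (proj1 (is_CInt_gen_eps _ _) (@S_int M) _ he3) as hS.
pose proof (proj1 (filterlimi_locally (U := R_NormedModule) _ _) g_int (mkposreal 1 Rlt_0_1))
  as hg.
apply: (filter_imp _ _ _ (filter_and _ _ near_half_line (filter_and _ _ hS hg))).
move=> [u v] /= [[hu huv] [[z1 [hz1 hz1']] [w [hw hw']]]].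
have [z hz] := exchange_ex_CInt hu huv.
exists z; split => //.
have hdiff : (Cmod (z - z1) <= E M * w)%R.
  apply: (@is_CInt_norm (fun x => f x + - (1) * S M x) (fun x => E M * g x)%R u v) => //.
  - move=> x hx; rewrite (_ : f x + - (1) * S M x = f x - S M x); last by ring.
    by apply: S_approx; lra.
  - rewrite (_ : z - z1 = z + - (1) * z1); last by ring.
    apply: (is_RInt_plus (V := C_R_NormedModule)) => //; exact: is_CInt_scal.
  - exact: (is_RInt_scal (V := R_NormedModule)).
have hw2 : (w <= Rabs G + 1)%R.
  have {}hw' : (Rabs (w - G) < 1)%R by [].
  by have := Rabs_def2 _ _ hw'; have := Rle_abs G; lra.
have := Rmult_le_compat_l _ _ _ (E_ge0 M) hw2.
rewrite (_ : z - l = (z - z1) + ((z1 - I M) + (I M - l))); last by ring.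
have := Cmod_triangle (z - z1) ((z1 - I M) + (I M - l)).
have := Cmod_triangle (z1 - I M) (I M - l).
by lra.
Qed.

End Exchange.

(** * The generalized Struve series *)

Lemma CSeries_lim (u : nat -> C) : ex_series (fun k => Cmod (u k)) ->
  clim (fun M => \big[Cplus/RtoC 0]_(k < M) u k) (CSeries u).
Proof.
move=> h.
have hS (f : C -> R) : (forall z : C, Rabs (f z) <= Cmod z)%R -> f (RtoC 0) = 0%R ->
    (forall z w : C, f (z + w)%C = f z + f w)%R ->
    is_lim_seq (fun M => f (\big[Cplus/RtoC 0]_(k < M) u k)) (Series (fun k => f (u k))).
  move=> hf f0 fD.
  have hs : ex_series (fun k => f (u k)).
    apply: (ex_series_le (V := R_CompleteNormedModule) _ (fun k => Cmod (u k))); last exact: h.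
    by move=> k; apply: (hf (u k)).
  apply/is_lim_seq_incr_1.
  apply: (is_lim_seq_ext (sum_n (fun k => f (u k)))); last exact: Series_correct.
  by move=> M; rewrite sum_n_big (big_morph f fD f0).
apply: clim_of_ReIm.
- by apply: hS => //; apply: re_le_Cmod.
- by apply: hS => //; apply: Im_le_Cmod.
Qed.

Lemma clim_prod (I : Type) (r : seq I) (u : I -> nat -> C) (l : I -> C) :
  (forall i, clim (u i) (l i)) ->
  clim (fun m => \big[Cmult/RtoC 1]_(i <- r) u i m) (\big[Cmult/RtoC 1]_(i <- r) l i).
Proof.
move=> h; elim: r => [|i r IH].
  rewrite big_nil; apply: (clim_ext_loc (M := 0%nat) _ (clim_const 1)).
  by move=> m _; rewrite big_nil.
rewrite big_cons; apply: (clim_ext_loc (M := 0%nat) _ (clim_mult (h i) IH)).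
by move=> m _; rewrite big_cons.
Qed.

Section Struve.
Variables (p b c : C) (y : R).
Hypothesis hy : (0 < y)%R.
Hypothesis hp : nonpole (p + (b + 2) / 2).

Definition struve_exp (k : nat) : C := RtoC (INR (2 * k)) + p + 1.

Definition struve_den (k : nat) : C :=
  Gamma (RtoC (INR k) + 3 / 2) * Gamma (RtoC (INR k) + p + (b + 2) / 2).

Definition struve_coef (k : nat) : C :=
  (- c) ^ k * Rcpow (y / 2) (struve_exp k) / struve_den k.

Lemma nonpole_32 : nonpole (3 / 2).
Proof.
apply: nonpole_Re; rewrite (_ : 3 / 2 = RtoC (3 / 2)); last by rewrite RtoC_div; [|lra].
by rewrite re_RtoC; lra.
Qed.

Lemma struve_denE k :
  struve_den k = Gamma (3 / 2 + RtoC (INR k)) * Gamma (p + (b + 2) / 2 + RtoC (INR k)).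
Proof. by rewrite /struve_den; congr (Gamma _ * Gamma _); ring. Qed.

Lemma struve_den_neq0 k : struve_den k <> 0.
Proof.
rewrite struve_denE; apply: Cmult_neq_0; apply: Gamma_neq0; apply: nonpole_plus_nat => //.
exact: nonpole_32.
Qed.

Lemma struve_den_succ k : struve_den k.+1 =
  (3 / 2 + RtoC (INR k)) * (p + (b + 2) / 2 + RtoC (INR k)) * struve_den k.
Proof.
rewrite !struve_denE S_INR RtoC_plus !Cplus_assoc !Gamma_succ; first by ring.
- exact: nonpole_plus_nat.
- exact: nonpole_plus_nat nonpole_32.
Qed.

(** The base is Cmod c + 1 instead of Cmod c: no term vanishes then, so that the
    ratio test applies even when c = 0. *)
Definition struve_bound (k : nat) : R :=
  ((Cmod c + 1) ^ k * Cmod (Rcpow (y / 2) (struve_exp k)) / Cmod (struve_den k))%R.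

Lemma struve_coef_le k : (Cmod (struve_coef k) <= struve_bound k)%R.
Proof.
rewrite /struve_coef /struve_bound Cmod_div; last exact: struve_den_neq0.
rewrite Cmod_mult Cmod_pow Cmod_opp.
have hd : (0 < Cmod (struve_den k))%R by apply/Cmod_gt_0/struve_den_neq0.
apply: Rmult_le_compat_r; first by apply/Rlt_le/Rinv_0_lt_compat.
apply: Rmult_le_compat_r; first exact: Cmod_ge_0.
by apply: pow_incr; have := Cmod_ge_0 c; lra.
Qed.

Lemma struve_bound_gt0 k : (0 < struve_bound k)%R.
Proof.
have hc := Cmod_ge_0 c.
apply: Rdiv_lt_0_compat; last by apply/Cmod_gt_0/struve_den_neq0.
apply: Rmult_lt_0_compat; first by apply: pow_lt; lra.
by apply/Cmod_gt_0/Rcpow_neq0.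
Qed.

Lemma struve_bound_ratio k : (struve_bound k.+1 / struve_bound k =
  (Cmod c + 1) * (y / 2 * (y / 2)) *
    / (Cmod (3 / 2 + RtoC (INR k)) * Cmod (p + (b + 2) / 2 + RtoC (INR k))))%R.
Proof.
have hc := Cmod_ge_0 c.
have hd : (0 < Cmod (struve_den k))%R by apply/Cmod_gt_0/struve_den_neq0.
have hr : (0 < Cmod (Rcpow (y / 2) (struve_exp k)))%R by apply/Cmod_gt_0/Rcpow_neq0.
have h1 : (0 < Cmod (3 / 2 + RtoC (INR k)))%R.
  by apply/Cmod_gt_0/nonpole_add/nonpole_32.
have h2 : (0 < Cmod (p + (b + 2) / 2 + RtoC (INR k)))%R by apply/Cmod_gt_0/nonpole_add.
have h3 : ((Cmod c + 1) ^ k <> 0)%R by apply: pow_nonzero; lra.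
rewrite /struve_bound struve_den_succ.
have -> : Rcpow (y / 2) (struve_exp k.+1) =
    Rcpow (y / 2) (struve_exp k) * RtoC (y / 2) * RtoC (y / 2).
  rewrite /struve_exp (_ : (2 * k.+1)%nat = ((2 * k).+2)%nat); last by rewrite mulnS.
  rewrite !S_INR !RtoC_plus (_ : _ + 1 + 1 + p + 1 = RtoC (INR (2 * k)) + p + 1 + 1 + 1);
    last by ring.
  by rewrite !Rcpow_plus Rcpow_1; [ring | lra].
move: (struve_den k) hd => d hd.
rewrite !Cmod_mult Cmod_R Rabs_pos_eq; last lra.
by rewrite -tech_pow_Rmult; field; repeat split; lra.
Qed.

Lemma struve_bound_summable : ex_series struve_bound.
Proof.
have h0 := struve_bound_gt0.
apply: (ex_series_ext (fun k => Rabs (struve_bound k))).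
  by move=> k; rewrite Rabs_pos_eq //; have := h0 k; lra.
apply: (ex_series_DAlembert _ 0); first exact: Rlt_0_1.
  by move=> k; have := h0 k; lra.
apply: (is_lim_seq_ext (fun k => Rabs (((Cmod c + 1) * (y / 2 * (y / 2))) *
    / (Cmod (3 / 2 + RtoC (INR k)) * Cmod (p + (b + 2) / 2 + RtoC (INR k)))))%R).
  by move=> k; rewrite struve_bound_ratio.
apply: (proj1 (is_lim_seq_abs_0 _)).
have hl z : is_lim_seq (fun k => Cmod (RtoC (INR k) / (z + RtoC (INR k))))%R 1.
  by rewrite -Cmod_1; apply: clim_mod; apply: clim_ratio_INR.
have lim : is_lim_seq (fun k => ((Cmod c + 1) * (y / 2 * (y / 2)) / INR k) * (1 / INR k) *
    (Cmod (RtoC (INR k) / (3 / 2 + RtoC (INR k))) *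
     Cmod (RtoC (INR k) / (p + (b + 2) / 2 + RtoC (INR k)))))%R 0.
  rewrite (_ : 0%R = (0 * 0 * (1 * 1))%R); last by ring.
  apply: is_lim_seq_mult'; apply: is_lim_seq_mult' => //; exact: is_lim_seq_inv_INR.
apply: is_lim_seq_ext_loc lim; exists 1%nat => k hk.
have hk0 : (0 < INR k)%R by apply: lt_0_INR; lia.
have n1 : 3 / 2 + RtoC (INR k) <> 0 by apply/nonpole_add/nonpole_32.
have n2 : p + (b + 2) / 2 + RtoC (INR k) <> 0 by apply/nonpole_add.
rewrite !Cmod_div // Cmod_R Rabs_pos_eq; last lra.
have {}n1 := proj1 (Cmod_gt_0 _) n1; have {}n2 := proj1 (Cmod_gt_0 _) n2.
by field; lra.
Qed.

(** Splitting the argument as q y separates the coefficient, which carries the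
    convergence, from a power of q. In the integral q is x / X(x). *)
Lemma struveW_lim (q : R) : (0 < q)%R -> (q <= 1)%R ->
  clim (fun M => \big[Cplus/RtoC 0]_(k < M) (struve_coef k * Rcpow q (struve_exp k)))
    (struveW p b c (q * y)).
Proof.
move=> hq hq1.
have -> : struveW p b c (q * y) = CSeries (fun k => struve_coef k * Rcpow q (struve_exp k)).
  rewrite /struveW; congr CSeries.
  apply: functional_extensionality => k.
  rewrite (_ : (q * y / 2 = y / 2 * q)%R); last by field.
  rewrite Rcpow_mult //; last lra.
  by rewrite /struve_coef /struve_den /struve_exp; rewrite /Cdiv; ring.
apply: CSeries_lim.
apply: (ex_series_le (V := R_CompleteNormedModule) _
  (fun k => struve_bound k * Cmod (Rcpow q (p + 1))))%R; last first.
  apply: (ex_series_ext (fun k => scal (Cmod (Rcpow q (p + 1))) (struve_bound k))).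
    by move=> k; rewrite /scal /= /mult /= Rmult_comm.
  exact: (ex_series_scal (V := R_NormedModule)) struve_bound_summable.
move=> k; rewrite /norm /= /abs /= Rabs_pos_eq; last exact: Cmod_ge_0.
rewrite Cmod_mult; apply: Rmult_le_compat; try exact: Cmod_ge_0.
  exact: struve_coef_le.
rewrite /struve_exp -Cplus_assoc Rcpow_plus Cmod_mult -[X in (_ <= X)%R]Rmult_1_l.
apply: Rmult_le_compat_r; first exact: Cmod_ge_0.
by apply: Cmod_Rcpow_le1 => //; rewrite re_RtoC; apply: pos_INR.
Qed.

End Struve.

(** * Integrating the product of Struve functions termwise *)

Section Main.
Variables (n : nat) (a : R) (y : 'I_n -> R) (b c lambda mu : C) (p : 'I_n -> C).
Hypothesis ha : (0 < a)%R.
Hypothesis hy : forall j, (0 < y j)%R.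
Local Notation P := (\big[Cplus/RtoC 0]_(j < n) p j).
Local Notation N := (RtoC (INR n)).
Hypothesis hmu : (- INR n < Re (mu + P))%R.
Hypothesis hlambda : (Re mu < Re lambda)%R.
Hypothesis hp : forall j, nonpole (p j + (b + 2) / 2).

Local Notation idx := {ffun 'I_n -> nat}.
Local Notation lam' := (lambda + P + N).
Local Notation mu' := (mu + P + N).

Let e (j : 'I_n) (k : nat) : C := struve_coef (p j) b c (y j) k.
Let D (j : 'I_n) (k : nat) : R := struve_bound (p j) b c (y j) k.
Let deg (k : idx) : R := \big[Rplus/0%R]_(m < n) INR (k m).

Let prefactor : C :=
  (lam' * Rcpow 2 (1 - mu - 2 * P - 2 * N)
     * Rcpow a (mu - lambda)
     * Gamma (lambda - mu) * Gamma (2 * mu + 2 * P + 2 * N)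
     * \big[Cmult/RtoC 1]_(j < n) Rcpow (y j) (p j + 1)
   / (Gamma (3 / 2) ^ n * Gamma (1 + lambda + mu + 2 * P + 2 * N)
     * \big[Cmult/RtoC 1]_(j < n) Gamma (p j + (b + 2) / 2))).

(** lterm, fterm and jterm are the terms of multi-index k in the Lauricella
    series, in the expanded integrand and in the integrated series. *)
Let lterm (k : idx) : C :=
  lauricella_coef
    [:: ((2 * mu + 2 * P + 2 * N)%C, fun _ : 'I_n => 4%R);
        ((1 + lambda + P + N)%C, fun _ : 'I_n => 2%R)]
    (fun _ : 'I_n => [:: (RtoC 1, 1%R)])
    [:: ((1 + lambda + mu + 2 * P + 2 * N)%C, fun _ : 'I_n => 4%R);
        ((lambda + P + N)%C, fun _ : 'I_n => 2%R)]
    (fun j : 'I_n => [:: ((3 / 2)%C, 1%R); ((p j + (b + 2) / 2)%C, 1%R)]) k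
  * \big[Cmult/RtoC 1]_(m < n)
      ((- (c * RtoC (y m) ^ 2) / 16) ^ k m / RtoC (INR (k m)`!)).

Let fterm (k : idx) (x : R) : C :=
  \big[Cmult/RtoC 1]_(j < n) e j (k j) *
    kernel a (lam' + 2 * RtoC (deg k)) (mu' + 2 * RtoC (deg k)) x.

Let jterm (k : idx) : C :=
  \big[Cmult/RtoC 1]_(j < n) e j (k j) *
  (2 * (lam' + 2 * RtoC (deg k)) * Rcpow a (- (lam' + 2 * RtoC (deg k)))
    * Rcpow (a / 2) (mu' + 2 * RtoC (deg k)) * Gamma (2 * (mu' + 2 * RtoC (deg k)))
    * Gamma (lam' + 2 * RtoC (deg k) - (mu' + 2 * RtoC (deg k)))
    / Gamma (1 + (lam' + 2 * RtoC (deg k)) + (mu' + 2 * RtoC (deg k)))).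

Lemma Re_mu' : (0 < Re mu')%R.
Proof. by rewrite Re_plus re_RtoC; move: hmu; lra. Qed.

Lemma Re_lam' : (Re mu' < Re lam')%R.
Proof. by rewrite !Re_plus; lra. Qed.

Lemma deg_ge0 k : (0 <= deg k)%R.
Proof.
rewrite /deg; elim/big_rec: _ => [|i x _ IH]; first lra.
by have := pos_INR (k i); lra.
Qed.

Lemma sum_struve_exp (k : idx) :
  \big[Cplus/RtoC 0]_(j < n) struve_exp (p j) (k j) = P + N + 2 * RtoC (deg k).
Proof.
rewrite /struve_exp !big_split Csum_const1 /=.
rewrite (eq_bigr (fun j : 'I_n => 2 * RtoC (INR (k j)))); last first.
  by move=> j _; rewrite mult_INR RtoC_mult.
by rewrite -big_distrr /= Csum_RtoC -Cplus_assoc Cplus_comm.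
Qed.

Lemma fterm_eq (k : idx) x : (0 < x)%R ->
  kernel a lambda mu x * \big[Cmult/RtoC 1]_(j < n)
    (e j (k j) * Rcpow (x / bigX a x) (struve_exp (p j) (k j))) = fterm k x.
Proof.
move=> hx.
rewrite big_split /= Rcpow_sum sum_struve_exp /fterm.
rewrite (_ : lam' + 2 * RtoC (deg k) = lambda + (P + N + 2 * RtoC (deg k))); last by ring.
rewrite (_ : mu' + 2 * RtoC (deg k) = mu + (P + N + 2 * RtoC (deg k))); last by ring.
by rewrite -kernel_shift // Cmult_assoc (Cmult_comm (kernel _ _ _ _)) -Cmult_assoc.
Qed.

Lemma D_pos j k : (0 <= D j k)%R.
Proof. by apply: Rlt_le; apply: struve_bound_gt0. Qed.

Lemma D_summable j : ex_series (D j).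
Proof. exact: struve_bound_summable. Qed.

(** Raising both parameters of the kernel by 2 deg k multiplies it by the power
    2 deg k of x / X(x), which is less than 1; one weight thus dominates all
    terms. *)
Lemma fterm_bound k x : (0 < x)%R ->
  (Cmod (fterm k x) <= Cmod (kernel a lam' mu' x) * box_weight D k)%R.
Proof.
move=> hx; have hq := ratio_bounds ha hx.
rewrite /fterm -kernel_shift // Cmod_mult (Cmod_mult (kernel _ _ _ _)) Cmod_prod Rmult_comm.
apply: Rmult_le_compat.
- by apply: Rmult_le_pos; apply: Cmod_ge_0.
- by apply: Rprod_ge0 => j; apply: Cmod_ge_0.
- rewrite -[X in (_ <= X)%R]Rmult_1_r; apply: Rmult_le_compat_l; first exact: Cmod_ge_0.
  apply: Cmod_Rcpow_le1 => //; rewrite re_scal_l re_RtoC.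
  by have := deg_ge0 k; lra.
- apply: Rprod_le => j; split; [exact: Cmod_ge_0 | exact: struve_coef_le].
Qed.

Lemma fterm_integral k :
  is_CInt_gen (fterm k) (at_right 0) (Rbar_locally p_infty) (jterm k).
Proof.
have h1 := Re_mu'; have h2 := Re_lam'; have h3 := deg_ge0 k.
apply: is_CInt_gen_scal; apply: kernel_integral => //.
- by rewrite (Re_plus mu') re_scal_l re_RtoC; lra.
- by rewrite (Re_plus mu') (Re_plus lam'); lra.
Qed.

Lemma prefactor_neq0 : prefactor <> 0.
Proof.
have h1 := Re_mu'; have h2 := Re_lam'.
have hlm : (0 < Re (lambda - mu))%R by rewrite Re_minus; lra.
rewrite /prefactor; apply: Cmult_neq_0.
- apply: Cmult_neq_0; last by apply: Cprod_neq0 => j; apply: Rcpow_neq0.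
  apply: Cmult_neq_0.
    apply: Cmult_neq_0; last exact: Gamma_neq0 (nonpole_Re hlm).
    apply: Cmult_neq_0; last exact: Rcpow_neq0.
    apply: Cmult_neq_0; last exact: Rcpow_neq0.
    by apply: Cneq0_Re; lra.
  apply/Gamma_neq0/nonpole_Re.
  rewrite (_ : 2 * mu + 2 * P + 2 * N = 2 * mu'); last by ring.
  by rewrite re_scal_l; lra.
- apply: Cinv_neq0; apply: Cmult_neq_0.
    apply: Cmult_neq_0; first by apply/Cpow_nz/Gamma_neq0/nonpole_32.
    apply/Gamma_neq0/nonpole_Re.
    rewrite (_ : 1 + lambda + mu + 2 * P + 2 * N = 1 + (lam' + mu')); last by ring.
    by rewrite Re_plus (Re_plus lam') re_RtoC; lra.
  by apply: Cprod_neq0 => j; apply: Gamma_neq0.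
Qed.

(** The common core of the Struve coefficient and of the factor of the Lauricella
    term that depend on the index k of the jth variable. *)
Let single (j : 'I_n) (k : nat) : C :=
  (- c) ^ k * (RtoC (y j) ^ (2 * k)) * / (16 ^ k)
  * (Gamma (3 / 2) * Gamma (p j + (b + 2) / 2) / struve_den (p j) b k).

Lemma Rcpow_2nat (x : R) k s : (0 < x)%R ->
  Rcpow x (RtoC (INR (2 * k)) + s) = RtoC x ^ (2 * k) * Rcpow x s.
Proof. by move=> hx; rewrite Rcpow_plus Rcpow_nat. Qed.

Lemma struve_coef_single j k : e j k =
  single j k * (4 ^ k * Rcpow (y j) (p j + 1) * / Rcpow 2 (p j + 1)
    / (Gamma (3 / 2) * Gamma (p j + (b + 2) / 2))).
Proof.
have hyj := hy j.
rewrite /e /struve_coef /single /struve_exp -Cplus_assoc Rcpow_div //; last lra.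
rewrite !Rcpow_2nat //; last lra.
have h1 := Gamma_neq0 nonpole_32; have h2 := Gamma_neq0 (@hp j).
have h3 := @struve_den_neq0 (p j) b (@hp j) k.
have h4 := @Rcpow_neq0 2 (p j + 1).
have h5 : RtoC 2 ^ (2 * k) = 4 ^ k.
  rewrite Cpow_mult_r; congr Cpow; rewrite !Cpow_S /= -!RtoC_mult; congr RtoC; ring.
have h6 : RtoC 16 ^ k = 4 ^ k * 4 ^ k.
  by rewrite -Cpow_mult_l -RtoC_mult; congr (RtoC _ ^ _); ring.
have h7 : RtoC 4 ^ k <> 0 by apply: Cpow_nz; move/RtoC_inj; lra.
by rewrite h5 h6; field; repeat split.
Qed.

Lemma lauricella_single j k :
  poch_single (RtoC 1, 1%R) k
    * ((- (c * RtoC (y j) ^ 2) / 16) ^ k / RtoC (INR k`!))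
  = single j k *
    (poch_single ((3 / 2)%C, 1%R) k * poch_single ((p j + (b + 2) / 2)%C, 1%R) k).
Proof.
rewrite /poch_single /pochhammer /single /= Rmult_1_r Gamma_one_plus_nat struve_denE.
have h1 := Gamma_neq0 nonpole_32; have h2 := Gamma_neq0 (@hp j).
have h3 := Gamma_neq0 (nonpole_plus_nat (k := k) nonpole_32).
have h4 := Gamma_neq0 (nonpole_plus_nat (k := k) (@hp j)).
have h5 : Gamma 1 <> 0 by apply/Gamma_neq0/nonpole_Re; rewrite re_RtoC; lra.
have h6 := @INR_fact_neq0 k.
have h7 : RtoC 16 <> 0 by move/RtoC_inj; lra.
have h8 : RtoC 16 ^ k <> 0 by apply: Cpow_nz.
have -> : (- (c * RtoC (y j) ^ 2) / 16) ^ k = (- c) ^ k * RtoC (y j) ^ (2 * k) / 16 ^ k.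
  rewrite (_ : - (c * RtoC (y j) ^ 2) / 16 = - c * (RtoC (y j) ^ 2) * / 16); last by field.
  by rewrite (Cpow_mult_l _ (/ 16)) (Cpow_mult_l (- c)) -Cpow_mult_r Cpow_inv.
by field; repeat split.
Qed.

Lemma lterm_eq k : lterm k =
  (Gamma (2 * mu' + 4 * RtoC (deg k)) / Gamma (2 * mu'))
  * ((lam' + 2 * RtoC (deg k)) / lam')
  / (Gamma (1 + lam' + mu' + 4 * RtoC (deg k)) / Gamma (1 + lam' + mu'))
  * \big[Cmult/RtoC 1]_(j < n) single j (k j).
Proof.
have h1 := Re_mu'; have h2 := Re_lam'; have h3 := deg_ge0 k.
have hlam0 : (0 < Re lam')%R by lra.
have hd (r : R) : RtoC (\big[Rplus/0%R]_(m < n) (INR (k m) * r)%R) = RtoC r * RtoC (deg k).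
  by rewrite -big_distrl /= Rmult_comm RtoC_mult.
rewrite /lterm /lauricella_coef !big_cons !big_nil !Cmult_1_r.
rewrite /poch_joint [fst _]/= /pochhammer !hd.
rewrite (_ : 2 * mu + 2 * P + 2 * N = 2 * mu'); last by ring.
rewrite (_ : 1 + lambda + mu + 2 * P + 2 * N = 1 + lam' + mu'); last by ring.
rewrite (_ : 1 + lambda + P + N = lam' + 1); last by ring.
rewrite (_ : lam' + 1 + 2 * RtoC (deg k) = lam' + 2 * RtoC (deg k) + 1); last by ring.
have q1 : (0 < Re (lam' + 2 * RtoC (deg k)))%R.
  by rewrite (Re_plus lam') re_scal_l re_RtoC; lra.
rewrite !Gamma_succ; [|exact: nonpole_Re|exact: nonpole_Re].
have g1 := Gamma_neq0 (nonpole_Re hlam0); have g2 := Gamma_neq0 (nonpole_Re q1).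
have g3 := Cneq0_Re hlam0.
have hden m : poch_single ((3 / 2)%C, 1%R) (k m)
    * poch_single ((p m + (b + 2) / 2)%C, 1%R) (k m) <> 0.
  rewrite /poch_single /pochhammer /= Rmult_1_r.
  by apply: Cmult_neq_0; apply: Cmult_neq_0; rewrite -?/(Cinv _);
    try apply: Cinv_neq0; apply: Gamma_neq0 => //; try apply: nonpole_plus_nat;
    try exact: nonpole_32.
have hprod := @Cprod_neq0 _ (index_enum 'I_n) _ hden.
have e1 : \big[Cmult/RtoC 1]_(m < n) \big[Cmult/RtoC 1]_(q <- [:: (RtoC 1, 1%R)])
      poch_single q (k m)
    * \big[Cmult/RtoC 1]_(m < n) ((- (c * RtoC (y m) ^ 2) / 16) ^ k m / RtoC (INR (k m)`!))
    = \big[Cmult/RtoC 1]_(m < n) single m (k m) *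
      \big[Cmult/RtoC 1]_(m < n) (poch_single ((3 / 2)%C, 1%R) (k m)
        * poch_single ((p m + (b + 2) / 2)%C, 1%R) (k m)).
  rewrite -!big_split /=; apply: eq_bigr => m _.
  by rewrite big_cons big_nil Cmult_1_r lauricella_single.
have e2 : \big[Cmult/RtoC 1]_(m < n) \big[Cmult/RtoC 1]_(q <- [:: ((3 / 2)%C, 1%R);
      ((p m + (b + 2) / 2)%C, 1%R)]) poch_single q (k m)
    = \big[Cmult/RtoC 1]_(m < n) (poch_single ((3 / 2)%C, 1%R) (k m)
        * poch_single ((p m + (b + 2) / 2)%C, 1%R) (k m)).
  by apply: eq_bigr => m _; rewrite !big_cons big_nil Cmult_1_r.
(* Over arbitrary complex numbers, so that the Gamma values and the big products
   are atoms for field. *)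
have key (A l1 g1' l0 g0 U Z Bq den s : C) : U * Z = s * den -> l0 <> 0 -> g1' <> 0 ->
    g0 <> 0 -> Bq <> 0 -> den <> 0 ->
    A * (l1 * g1' / (l0 * g0)) * U / (Bq * (g1' / g0) * den) * Z = A * (l1 / l0) / Bq * s.
  move=> h a1 a2 a3 a4 a5.
  rewrite (_ : _ * Z = A * l1 / (l0 * Bq * den) * (U * Z)); last by field.
  by rewrite h; field.
rewrite e2; apply: key => //.
have hB : (0 < Re (1 + lam' + mu'))%R by rewrite (Re_plus (1 + lam')) (Re_plus 1) re_RtoC; lra.
apply: Cmult_neq_0; last exact: Cinv_neq0 (Gamma_neq0 (nonpole_Re hB)).
apply/Gamma_neq0/nonpole_Re.
by rewrite (Re_plus (1 + lam' + mu')) re_scal_l re_RtoC; lra.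
Qed.

(** In the constant of the kernel integral the factor (a/2)^(mu+P+N+2 deg k)
    contributes 4^(- deg k), and so do the powers of y/2 in the Struve
    coefficients: together they give the 16 in the arguments of the Lauricella
    function. The factor lambda+P+N+2 deg k is lambda+P+N, which goes into the
    prefactor, times the quotient of the two Pochhammer symbols with step 2. *)
Lemma jterm_eq k : jterm k = prefactor * lterm k.
Proof.
have h1 := Re_mu'; have h2 := Re_lam'; have h3 := deg_ge0 k.
have hP : \big[Cmult/RtoC 1]_(j < n) e j (k j) =
    \big[Cmult/RtoC 1]_(j < n) single j (k j)
    * (Rcpow 2 (2 * RtoC (deg k)) * \big[Cmult/RtoC 1]_(j < n) Rcpow (y j) (p j + 1)
       * / Rcpow 2 (P + N))
    / (Gamma (3 / 2) ^ n * \big[Cmult/RtoC 1]_(j < n) Gamma (p j + (b + 2) / 2)).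
  have hnz : Gamma (3 / 2) ^ n * \big[Cmult/RtoC 1]_(j < n) Gamma (p j + (b + 2) / 2) <> 0.
    apply: Cmult_neq_0; first by apply/Cpow_nz/Gamma_neq0/nonpole_32.
    by apply: Cprod_neq0 => j; apply: Gamma_neq0.
  have e1 : Rcpow 2 (P + N) = \big[Cmult/RtoC 1]_(j < n) Rcpow 2 (p j + 1).
    by rewrite Rcpow_sum big_split /= Csum_const1.
  have e2 : Rcpow 2 (2 * RtoC (deg k)) = \big[Cmult/RtoC 1]_(j < n) 4 ^ k j.
    rewrite /deg -Csum_RtoC big_distrr /= -Rcpow_sum; apply: eq_bigr => j _.
    rewrite (_ : 2 * RtoC (INR (k j)) = RtoC (INR (k j)) + RtoC (INR (k j))); last by ring.
    rewrite Rcpow_plus Rcpow_nat; last lra.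
    by rewrite -Cpow_mult_l -RtoC_mult; congr (RtoC _ ^ _); ring.
  have hn2 : Rcpow 2 (P + N) <> 0 by apply: Rcpow_neq0.
  have e3 : \big[Cmult/RtoC 1]_(j < n) e j (k j) * (Rcpow 2 (P + N) *
      (Gamma (3 / 2) ^ n * \big[Cmult/RtoC 1]_(j < n) Gamma (p j + (b + 2) / 2))) =
      \big[Cmult/RtoC 1]_(j < n) single j (k j) *
      (Rcpow 2 (2 * RtoC (deg k)) * \big[Cmult/RtoC 1]_(j < n) Rcpow (y j) (p j + 1)).
    rewrite e1 e2 -Cprod_const -!big_split /=; apply: eq_bigr => j _.
    rewrite struve_coef_single.
    have g1 := Gamma_neq0 nonpole_32; have g2 := Gamma_neq0 (@hp j).
    have g3 := @Rcpow_neq0 2 (p j + 1).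
    by field; repeat split.
  have aux (E P2 Gm S T Y : C) : P2 <> 0 -> Gm <> 0 -> E * (P2 * Gm) = S * (T * Y) ->
      E = S * (T * Y * / P2) / Gm.
    move=> a1 a2 h; rewrite (_ : S * (T * Y * / P2) / Gm = S * (T * Y) / (P2 * Gm));
      last by field.
    by rewrite -h; field.
  exact: aux.
rewrite lterm_eq /jterm /prefactor hP.
have -> : lam' + 2 * RtoC (deg k) - (mu' + 2 * RtoC (deg k)) = lambda - mu by ring.
have -> : 2 * (mu' + 2 * RtoC (deg k)) = 2 * mu' + 4 * RtoC (deg k).
  by rewrite (_ : 4 = (2 * 2)%R) ?RtoC_mult; ring.
have -> : 1 + (lam' + 2 * RtoC (deg k)) + (mu' + 2 * RtoC (deg k)) =
    1 + lam' + mu' + 4 * RtoC (deg k).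
  by rewrite (_ : 4 = (2 * 2)%R) ?RtoC_mult; ring.
have -> : 2 * mu + 2 * P + 2 * N = 2 * mu' by ring.
have -> : 1 + lambda + mu + 2 * P + 2 * N = 1 + lam' + mu' by ring.
have hpow : 2 * Rcpow a (- (lam' + 2 * RtoC (deg k))) * Rcpow (a / 2) (mu' + 2 * RtoC (deg k))
    * (Rcpow 2 (2 * RtoC (deg k)) * / Rcpow 2 (P + N))
    = Rcpow 2 (1 - mu - 2 * P - 2 * N) * Rcpow a (mu - lambda).
  rewrite Rcpow_div //; last lra.
  rewrite (_ : 1 - mu - 2 * P - 2 * N = 1 + - (mu' + 2 * RtoC (deg k)) +
    2 * RtoC (deg k) + - (P + N)); last by ring.
  rewrite (_ : mu - lambda = - (lam' + 2 * RtoC (deg k)) + (mu' + 2 * RtoC (deg k)));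
    last by ring.
  have powers (L M d Q : C) : 2 * Rcpow a (- L) * (Rcpow a M / Rcpow 2 M) *
      (Rcpow 2 d * / Rcpow 2 Q) = Rcpow 2 (1 + - M + d + - Q) * Rcpow a (- L + M).
    by rewrite !Rcpow_plus !(Rcpow_opp 2) Rcpow_1 /Cdiv; [ring | lra].
  exact: powers.
have g1 : Gamma (2 * mu') <> 0 by apply/Gamma_neq0/nonpole_Re; rewrite re_scal_l; lra.
have g2 : Gamma (1 + lam' + mu') <> 0.
  by apply/Gamma_neq0/nonpole_Re; rewrite (Re_plus (1 + lam')) (Re_plus 1) re_RtoC; lra.
have g3 : Gamma (1 + lam' + mu' + 4 * RtoC (deg k)) <> 0.
  apply/Gamma_neq0/nonpole_Re.
  by rewrite (Re_plus (1 + lam' + mu')) (Re_plus (1 + lam')) (Re_plus 1) re_scal_l !re_RtoC; lra.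
have g4 : lam' <> 0 by apply: Cneq0_Re; lra.
(* Again over arbitrary numbers; only the powers of 2 and a need an argument,
   which is hpow. *)
have aux (S T Y iP G3 GP l1 a1 a2 G4 Glm G5 l0 q2 qa G4' G5' : C) :
    2 * a1 * a2 * (T * iP) = q2 * qa -> l0 <> 0 -> G4' <> 0 -> G5 <> 0 -> G5' <> 0 ->
    G3 * GP <> 0 ->
    S * (T * Y * iP) / (G3 * GP) * (2 * l1 * a1 * a2 * G4 * Glm / G5) =
    l0 * q2 * qa * Glm * G4' * Y / (G3 * G5' * GP) *
      (G4 / G4' * (l1 / l0) / (G5 / G5') * S).
  move=> h n1 n2 n3 n4 n5.
  have n6 : G3 <> 0 by move=> e0; apply: n5; rewrite e0 Cmult_0_l.
  have n7 : GP <> 0 by move=> e0; apply: n5; rewrite e0 Cmult_0_r.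
  rewrite (_ : l0 * q2 * qa * Glm * G4' * Y = l0 * (q2 * qa) * Glm * G4' * Y); last by ring.
  by rewrite -h; field; repeat split.
apply: aux => //.
apply: Cmult_neq_0; first by apply/Cpow_nz/Gamma_neq0/nonpole_32.
by apply: Cprod_neq0 => j; apply: Gamma_neq0.
Qed.

(** Since the prefactor is nonzero, the bound on the integrated terms also bounds
    the Lauricella terms, which gives their unconditional summability. *)
Lemma main_integral : exists F : C, is_sum_over lterm F /\
  is_CInt_gen (fun x => kernel a lambda mu x *
      \big[Cmult/RtoC 1]_(j < n) struveW (p j) b c (x / bigX a x * y j))
    (at_right 0) (Rbar_locally p_infty) (prefactor * F).
Proof.
have h1 := Re_mu'; have h2 := Re_lam'.
have [G hG] := Cmod_kernel_integral ha h1 h2.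
have hpre := prefactor_neq0.
have hpre0 : (0 < Cmod prefactor)%R by apply/Cmod_gt_0.
have hJ k : (Cmod (jterm k) <= box_weight D k * G)%R.
  have hG' : is_RInt_gen (fun x => box_weight D k * Cmod (kernel a lam' mu' x))%R
      (at_right 0) (Rbar_locally p_infty) (box_weight D k * G)%R.
    exact: is_RInt_gen_scal hG.
  apply: (is_CInt_gen_norm _ _ (@fterm_integral k) hG').
  - by apply: filter_imp near_half_line => ab [].
  - apply: filter_imp near_half_line => ab [h0 _] x [hx _].
    rewrite Rmult_comm; apply: fterm_bound.
    exact: Rlt_le_trans hx.
have hL k : (Cmod (lterm k) <= G / Cmod prefactor * box_weight D k)%R.
  have := hJ k; rewrite jterm_eq Cmod_mult => h.
  apply: (Rmult_le_reg_l (Cmod prefactor)) => //.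
  apply: Rle_trans h _; apply: Req_le; field; lra.
(* G bounds the modulus of the integral of a kernel. *)
have G_ge0 : (0 <= G)%R.
  apply: Rle_trans (Cmod_ge_0 _) (is_CInt_gen_norm _ _ (kernel_integral ha h1 h2) hG).
  - by apply: filter_imp near_half_line => ab [].
  - by apply: filter_forall => ab x _; apply: Rle_refl.
have hc : (0 <= G / Cmod prefactor)%R.
  by apply: Rmult_le_pos => //; apply/Rlt_le/Rinv_0_lt_compat.
have [F [hF limF]] := dominated_summable D_pos D_summable hL hc.
exists F; split => //.
have tail0 := box_tail_lim D_summable.
apply: (@exchange_integral _ (fun M x => \Csum_(k <- box n M) fterm k x)
  (fun x => Cmod (kernel a lam' mu' x)) G (box_tail D) _ tail0 _ _ _
  (fun M => \Csum_(k <- box n M) jterm k)) => //.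
- by move=> M; apply: box_tail_ge0 => //; [exact: D_pos | exact: D_summable].
- by move=> x hx; apply: continuous_Cmod_kernel.
- move=> M x hx; elim: (box n M) => [|k s IH].
    rewrite (_ : (fun x => _) = fun=> RtoC 0); first exact: ccont_const.
    by apply: functional_extensionality => t; rewrite big_nil.
  rewrite (_ : (fun x => _) = fun x => fterm k x + \Csum_(k <- s) fterm k x).
    apply: ccont_plus => //; apply: ccont_mult; first exact: ccont_const.
    exact: ccont_kernel.
  by apply: functional_extensionality => t; rewrite big_cons.
- move=> M x hx.
  have [hq hq1] := ratio_bounds ha hx.
  have hlim : clim (fun M => \Csum_(k <- box n M) fterm k x)
      (kernel a lambda mu x *
        \big[Cmult/RtoC 1]_(j < n) struveW (p j) b c (x / bigX a x * y j)).
    have := clim_mult (clim_const (kernel a lambda mu x)) (clim_prod (index_enum 'I_n)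
      (fun j => struveW_lim c (hy j) (@hp j) hq hq1)).
    apply: (clim_ext_loc (M := 0%nat)) => M' _.
    pose u j k := e j k * Rcpow (x / bigX a x) (struve_exp (p j) k).
    rewrite [X in _ * X](_ : _ = \Csum_(k <- box n M') \big[Cmult/RtoC 1]_(j < n) u j (k j));
      last exact: (@box_distr n C (RtoC 0) (RtoC 1) Cmult Cplus u M').
    rewrite big_distrr /=; apply: eq_bigr => k _; exact: fterm_eq.
  have hb k : (Cmod (fterm k x) <= Cmod (kernel a lam' mu' x) * box_weight D k)%R.
    exact: fterm_bound.
  have := clim_mod (clim_plus hlim (clim_const (- \Csum_(k <- box n M) fterm k x))).
  move=> hl.
  have hconst := is_lim_seq_const (box_tail D M * Cmod (kernel a lam' mu' x)).
  suff hev : eventually (fun M' => Cmod (\Csum_(k <- box n M') fterm k x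
      + - \Csum_(k <- box n M) fterm k x) <= box_tail D M * Cmod (kernel a lam' mu' x))%R.
    exact: (is_lim_seq_le_loc _ _ _ _ hev hl hconst).
  exists M => M' hM; rewrite Rmult_comm.
  apply: (dominated_box_bound D_pos D_summable hb (Cmod_ge_0 _)).
  by apply/leP.
- by move=> M; apply: is_CInt_gen_sum => k; apply: fterm_integral.
- have := clim_mult (clim_const prefactor) limF.
  apply: (clim_ext_loc (M := 0%nat)) => M _.
  by rewrite big_distrr /=; apply: eq_bigr => k _; rewrite jterm_eq.
Qed.

End Main.

Theorem theorem2 (n : nat) (hn : (0 < n)%nat)
    (a : R) (y : 'I_n -> R) (b c lambda mu : C) (p : 'I_n -> C)
    (ha : (0 < a)%R) (hy : forall j : 'I_n, (0 < y j)%R)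
    (hmu : (- INR n < Re (mu + \big[Cplus/RtoC 0]_(j < n) p j)%C)%R)
    (hlambda : (Re mu < Re lambda)%R)
    (hp : forall (j : 'I_n) (m : nat),
        (p j + (b + 2) / 2)%C <> (- RtoC (INR m))%C) :
  let P : C := \big[Cplus/RtoC 0]_(j < n) p j in
  let N : C := RtoC (INR n) in
  let X : R -> R := fun x => (x + a + sqrt (x ^ 2 + 2 * a * x))%R in
  let B : C :=
    ((lambda + P + N) * Rcpow 2 (1 - mu - 2 * P - 2 * N)
       * Rcpow a (mu - lambda)
       * Gamma (lambda - mu) * Gamma (2 * mu + 2 * P + 2 * N)
       * \big[Cmult/RtoC 1]_(j < n) Rcpow (y j) (p j + 1)
     / (Gamma (3 / 2) ^ n * Gamma (1 + lambda + mu + 2 * P + 2 * N)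
       * \big[Cmult/RtoC 1]_(j < n) Gamma (p j + (b + 2) / 2)))%C in
  exists F : C,
    is_lauricella
      [:: ((2 * mu + 2 * P + 2 * N)%C, fun _ : 'I_n => 4%R);
          ((1 + lambda + P + N)%C, fun _ : 'I_n => 2%R)]
      (fun _ : 'I_n => [:: (RtoC 1, 1%R)])
      [:: ((1 + lambda + mu + 2 * P + 2 * N)%C, fun _ : 'I_n => 4%R);
          ((lambda + P + N)%C, fun _ : 'I_n => 2%R)]
      (fun j : 'I_n => [:: ((3 / 2)%C, 1%R); ((p j + (b + 2) / 2)%C, 1%R)])
      (fun j : 'I_n => (- (c * RtoC (y j) ^ 2) / 16)%C)
      F
    /\ is_RInt_gen (V := C_R_NormedModule)
         (fun x : R =>
            (Rcpow x (mu - 1) * Rcpow (X x) (- lambda)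
             * \big[Cmult/RtoC 1]_(j < n)
                 struveW (p j) b c (x * y j / X x)%R)%C)
         (at_right 0%R) (Rbar_locally p_infty) (B * F)%C.
Proof.
move=> P N X B.
have [F [hF hI]] := main_integral c ha hy hmu hlambda hp.
exists F; split => //.
apply: (is_RInt_gen_ext (V := C_R_NormedModule) _ _ _ _ hI).
apply: filter_forall => ab x _; congr (_ * _); apply: eq_bigr => j _.
by congr struveW; rewrite /X /bigX /Rdiv; ring.
Qed.
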